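(* Let $W$ be a DMC satisfying (A1) of the context and fix $\epsilon\in(0,1)$. There is a constant $c_1>0$ such that the number $M[\mathscr P_1^c]$ of codewords of any blocklength-$n$ code whose codewords all lie in $\mathcal X^n\setminus\mathsf F_1$, where $\mathsf F_1=\{\mathbf x\in\mathcal X^n:\hat P_{\mathbf x}\in\Pi^*(\frac{1}{n^{1/4}\log n})\}$, and whose average error probability is at most $\epsilon$, satisfies \[ \log M[\mathscr P_1^c]\le nC-\sqrt{nV_\epsilon}\,t_\epsilon-\frac{c_1n^{1/4}}{\log n}[1+o(1)]. \]
   Context: DMC $W$ with finite $\mathcal X,\mathcal Y$, $W_x=W(\cdot|x)$, $(PW)(y)=\sum_xP(x)W(y|x)$; $\hat P_{\mathbf x}$ the type (empirical distribution) of $\mathbf x$. $D(P\|Q)=E_P\log\frac PQ$, $V(P\|Q)=\mathrm{Var}_P\log\frac PQ$; $I(P;W)=\sum_xP(x)D(W_x\|PW)$, $V(P;W)=\sum_xP(x)V(W_x\|PW)$. $C=\max_PI(P;W)$, $Q^*$ the unique capacity-achieving output distribution, $\Pi=\{P:PW=Q^*\}$, $\tilde v(x)=V(W_x\|Q^* )$, $V_{\min},V_{\max}$ min/max of $V(P;W)$ over $\Pi$. $t_\epsilon=Q^{-1}(\epsilon)$ ($Q=1-\Phi$ the standard normal tail); $V_\epsilon=V_{\min}$ if $\epsilon\le\frac12$ else $V_{\max}$; $\Pi^*=\{P\in\Pi:\sum P(x)\tilde v(x)=V_\epsilon\}$ ($=\Pi$ if $\epsilon=\frac12$); $\Pi^*(\delta)=\{P:\min_{P'\in\Pi^*}\|P-P'\|_\infty\le\delta\}$.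 (A1): $V_{\min}>0$. Average error probability is $\frac1M\sum_me(m)$ with $e(m)$ the error probability of message $m$. *)

(* Defs.v *)
From HB Require Import structures.
From mathcomp Require Import all_boot all_order all_algebra.
From mathcomp Require Import all_classical all_reals all_analysis.
Set Implicit Arguments. Unset Strict Implicit. Unset Printing Implicit Defensive.
Import Order.TTheory GRing.Theory Num.Theory Num.Def.
Import numFieldNormedType.Exports.
Local Open Scope classical_set_scope.
Local Open Scope ring_scope.

Section DMC.
Context {R : realType} {X Y : finType}.

Definition is_dist (T : finType) (P : T -> R) :=
  (forall t, 0 <= P t) /\ \sum_(t : T) P t = 1.

Definition channel (W : X -> Y -> R) := forall x, is_dist (W x).

Definition outdist (P : X -> R) (W : X -> Y -> R) : Y -> R :=
  fun y => \sum_(x : X) P x * W x y.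

Definition llr (P Q : Y -> R) (y : Y) := ln (P y / Q y).
Definition divD (P Q : Y -> R) : R :=
  \sum_(y : Y | P y != 0) P y * llr P Q y.
Definition divV (P Q : Y -> R) : R :=
  \sum_(y : Y | P y != 0) P y * (llr P Q y - divD P Q) ^+ 2.

Definition mutI (P : X -> R) (W : X -> Y -> R) : R :=
  \sum_(x : X) P x * divD (W x) (outdist P W).
Definition dispV (P : X -> R) (W : X -> Y -> R) : R :=
  \sum_(x : X) P x * divV (W x) (outdist P W).

Definition capacity (W : X -> Y -> R) : R :=
  sup [set mutI P W | P in [set P | is_dist P]].

(* Pi = {P : PW = Q*}, Q* = P'W for a (any) capacity-achieving P' *)
Definition Pi (W : X -> Y -> R) : set (X -> R) :=
  [set P | is_dist P /\ exists P', is_dist P' /\ mutI P' W = capacity W /\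
                                    outdist P W = outdist P' W].

Definition Vmin (W : X -> Y -> R) : R := inf [set dispV P W | P in Pi W].
Definition Vmax (W : X -> Y -> R) : R := sup [set dispV P W | P in Pi W].

Definition Veps (W : X -> Y -> R) (eps : R) : R :=
  if eps <= 2^-1 then Vmin W else Vmax W.

(* Pi^*; for P in Pi, dispV P W = sum_x P(x) V(W_x||Qstar) *)
Definition Pistar (W : X -> Y -> R) (eps : R) : set (X -> R) :=
  if eps == 2^-1 then Pi W
  else [set P | Pi W P /\ dispV P W = Veps W eps].

Definition supdist (P P' : X -> R) : R := \big[maxr/0]_(x : X) `|P x - P' x|.

Definition Pistar_nbhd (W : X -> Y -> R) (eps delta : R) : set (X -> R) :=
  [set P | exists P', Pistar W eps P' /\ supdist P P' <= delta].

Definition A1 (W : X -> Y -> R) := 0 < Vmin W.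

Definition ptype (n : nat) (x : {ffun 'I_n -> X}) : X -> R :=
  fun a => #|[set i | x i == a]|%:R / n%:R.

Definition Wn (W : X -> Y -> R) (n : nat) (x : {ffun 'I_n -> X})
  (y : {ffun 'I_n -> Y}) : R := \prod_(i < n) W (x i) (y i).

Definition avg_err (W : X -> Y -> R) (n M : nat) (f : 'I_M -> {ffun 'I_n -> X})
  (g : {ffun 'I_n -> Y} -> 'I_M) : R :=
  M%:R^-1 * \sum_(m < M) (1 - \sum_(y | g y == m) Wn W (f m) y).

End DMC.

(* Gaussian tail Q(t) = 1 - Phi(t), and t_eps = Q^{-1}(eps) *)
Definition Qtail {R : realType} (t : R) : R :=
  (\int[@lebesgue_measure R]_(u in `[t, +oo[) normal_pdf 0 1 u)%R.
Definition teps {R : realType} (eps : R) : R := sup [set t : R | eps <= Qtail t].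

(* Main.v *)
(* Let [q] be the capacity-achieving output law, [P] the type of a codeword and
   [u] the distance between [PW] and [q].  Test the codeword against the product
   of [q] tilted slightly towards [PW]: the mean log-likelihood ratio per letter
   falls short of [C] by at least a multiple of [u^2], and its variance is within
   [O(u)] of [v(P)], the sum of [P(x) V(W_x || q)], which is linear in [P].  By
   Hoffman's error bound for polytopes, a type outside [Pi^*(delta)] makes
   [u + sgn(t_eps) (v(P) - V_eps)] at least of order [delta].  Hence [n u^2] plus
   the gain [t_eps sqrt n] times the increase of the standard deviation is of order
   at least [sqrt n * delta = n^(1/4) / log n], up to a constant.  A Berry-Esseen
   bound, obtained by Stein's method, converts this into error probability; an
   approximation error of order [n^(-1/4)] would already be too large.  Grouping
   the messages by type costs only [O(log n)]. *)

Require Import Defs.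
From HB Require Import structures.
From mathcomp Require Import all_boot all_order all_algebra.
From mathcomp Require Import all_classical all_reals all_analysis.
From mathcomp Require Import measurable_realfun ring lra zify.
Import Order.TTheory GRing.Theory Num.Theory Num.Def.
Import numFieldNormedType.Exports.
Local Open Scope classical_set_scope.
Local Open Scope ring_scope.
Set Implicit Arguments. Unset Strict Implicit. Unset Printing Implicit Defensive.

(** * The Gaussian tail *)

Section Gaussian.
Context {R : realType}.
Notation phi := (normal_pdf (0 : R) 1).
Notation mu := (@lebesgue_measure R).
Implicit Types (t u w z : R).

(** Neither of the two obvious test laws works. Against [q] itself the mean per letter can equal [C]
    although [PW] differs from [q], because many inputs may have divergence exactly [C]; nothing is
    gained then. Against [PW] the quadratic gain is present, but the ratios are unbounded where [PW]
    is small, so no uniform Berry-Esseen constant exists. The tilt keeps the gain up to a factor and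
    the ratios bounded. The variance is known only up to a loss linear in [u], which is [sqrt n * u]
    on the scale of the threshold and may exceed the gain. But [n u^2] minus a multiple of
    [sqrt n * u] is bounded below by a constant, so the quadratic term absorbs this loss. After
    normalisation the gain is [n^(-1/4) / log n], against a Berry-Esseen error of order [n^(-1/2)].
    That error bound needs a variance bounded away from 0. Types violating this have [u] bounded
    below, hence a mean deficit of order [n], and Chebyshev's inequality suffices for them. *)

Lemma MVT_real (f df : R -> R) (a b : R) : a <= b ->
  (forall x : R, is_derive x 1 f (df x)) ->
  exists2 c, a <= c <= b & f b - f a = df c * (b - a).
Proof.
move=> ab fdf.
have cf : {within `[a, b], continuous f}.
  apply: continuous_subspaceT => x.
  by apply: differentiable_continuous; apply/derivable1_diffP; apply: ex_derive.
have [c cab ->] := @MVT_segment R f df a b ab (fun x _ => fdf x) cf.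
by exists c => //; rewrite in_itv/= in cab.
Qed.

Lemma stdnormal_pdfE u : phi u = normal_peak (1 : R) * expR (- (u ^+ 2 / 2)).
Proof.
by rewrite normal_pdfE ?oner_eq0// /normal_fun subr0 expr1n mulNr.
Qed.

Lemma stdnormal_pdf_gt0 u : 0 < phi u.
Proof. by rewrite stdnormal_pdfE mulr_gt0 ?expR_gt0// normal_peak_gt0// oner_eq0. Qed.

Lemma stdnormal_pdfN u : phi (- u) = phi u.
Proof. by rewrite !stdnormal_pdfE sqrrN. Qed.

Lemma is_derive_stdnormal_pdf u : is_derive u 1 phi (- u * phi u).
Proof.
rewrite (_ : normal_pdf 0 1 = fun u : R => normal_peak (1 : R) * expR (- (u ^+ 2 / 2))); last first.
  by apply/funext => x; rewrite stdnormal_pdfE.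
have h : is_derive u 1 (fun u : R => - (u ^+ 2 / 2)) (- u).
  have h1 : is_derive u 1 (fun u : R => u * u) (u + u).
    by apply: is_derive_eq; rewrite /GRing.scale/= !mulr1.
  have h2 : is_derive u 1 (fun u : R => (- 2^-1) *: (u * u)) ((- 2^-1) *: (u + u)).
    exact: is_deriveZ.
  rewrite (_ : (fun u : R => - (u ^+ 2 / 2)) = (fun u : R => (- 2^-1) *: (u * u))).
    by apply: (is_derive_eq h2); rewrite /GRing.scale/=; lra.
  by apply/funext => x; rewrite /GRing.scale/= expr2; lra.
have h2 : is_derive u 1 (fun u : R => expR (- (u ^+ 2 / 2))) (- u * expR (- (u ^+ 2 / 2))).
  have h3 := @is_derive1_comp R expR (fun u : R => - (u ^+ 2 / 2)) u _ _ (is_derive_expR _) h.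
  by apply: (is_derive_eq h3); rewrite mulrC.
have h3 := is_deriveZ (normal_peak (1 : R)) h2.
apply: (is_derive_eq h3); rewrite /GRing.scale/=; ring.
Qed.

Lemma integrable_stdnormal_pdf (D : set R) : measurable D ->
  mu.-integrable D (EFin \o phi).
Proof.
move=> mD; apply: (@integrableS _ _ _ _ setT) => //.
exact: integrable_normal_pdf.
Qed.

(** The tail becomes an integral with variable upper endpoint, the form that the fundamental theorem
    of calculus differentiates. *)
Lemma Qtail_compl t : Qtail t = 1 - (\int[mu]_(u in `]-oo, t]) phi u)%R.
Proof.
have : (\int[mu]_u phi u)%R = 1 :> R.
  by rewrite /Rintegral integral_normal_pdf.
rewrite (_ : [set: R] = `]-oo, t]%classic `|` `]t, +oo[%classic); last first.
  by apply/esym; rewrite -subTset => x _/=; rewrite !in_itv/= andbT; case: (leP x t); [left|right].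
rewrite Rintegral_setU//; last 2 first.
- by apply: integrable_stdnormal_pdf; apply: measurableU; exact: measurable_itv.
- apply/disj_setPS => x/= []; rewrite !in_itv/= andbT => h1 h2; lra.
rewrite (Rintegral_itv_obnd_cbnd (r := t)); last first.
  by apply: integrable_stdnormal_pdf; exact: measurable_itv.
by rewrite -/(Qtail t) => /(canRL (addKr _)) ->; rewrite addrC.
Qed.

Lemma is_derive_onem_derive1 (F : R -> R) (a : R) t : derivable F t 1 ->
  (F^`()%classic) t = a -> is_derive t 1 (fun x => 1 - F x) (- a).
Proof.
move=> dF <-; rewrite derive1E.
have h := is_deriveB (is_derive_cst (1 : R) t 1) (derivableP dF).
by apply: (is_derive_eq h); rewrite sub0r.
Qed.

Lemma is_derive_Qtail t : is_derive t 1 Qtail (- phi t).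
Proof.
have [||||dF eF] := @continuous_FTC1 R phi -oo%O t (t + 1).
- by rewrite ltrDl.
- by apply: integrable_stdnormal_pdf; exact: measurable_itv.
- exact: ltNyr.
- by apply: continuous_normal_pdf; rewrite oner_eq0.
have := is_derive_onem_derive1 dF eF.
by congr (is_derive _ _ _ _); apply/funext => x; rewrite Qtail_compl.
Qed.

Lemma QtailN t : Qtail (- t) = 1 - Qtail t.
Proof.
rewrite Qtail_compl; congr (_ - _).
rewrite /Qtail /Rintegral; congr fine.
rewrite (@ge0_integration_by_substitutionNy R phi t).
- by apply: eq_integral => x _ /=; rewrite stdnormal_pdfN.
- by apply: continuous_subspaceT; apply: continuous_normal_pdf; rewrite oner_eq0.
- by move=> x _; exact: normal_pdf_ge0.
Qed.

Lemma Qtail_ge0 t : 0 <= Qtail t.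
Proof. by apply: Rintegral_ge0 => x _; exact: normal_pdf_ge0. Qed.

Lemma Qtail_le1 t : Qtail t <= 1.
Proof. by have := Qtail_ge0 (- t); rewrite QtailN subr_ge0. Qed.

Lemma Qtail0 : Qtail (0 : R) = 2^-1.
Proof. have := QtailN 0; rewrite oppr0; lra. Qed.

Lemma Qtail_decr (a b : R) : a < b -> Qtail b < Qtail a.
Proof.
move=> ab; have [c _ h] := MVT_real (ltW ab) is_derive_Qtail.
by rewrite -subr_lt0 h mulNr oppr_lt0 mulr_gt0 ?subr_gt0 ?stdnormal_pdf_gt0.
Qed.

Lemma Qtail_le (a b : R) : a <= b -> Qtail b <= Qtail a.
Proof. by rewrite le_eqVlt => /predU1P[->//|/Qtail_decr/ltW]. Qed.

Lemma stdnormal_pdf_cvg0 : phi x @[x --> +oo%R] --> (0 : R).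
Proof.
apply: (@squeeze_cvgr _ _ _ _ (fun=> 0) (fun x : R => normal_peak (1 : R) * (expR 1 * expR (- x)))).
- apply: nearW => x; rewrite normal_pdf_ge0/= stdnormal_pdfE -expRD.
  rewrite ler_wpM2l ?normal_peak_ge0// ler_expR.
  (* The square gives [x <= x^2 / 2 + 1], hence domination by a multiple of [exp (- x)]. *)
  have := sqr_ge0 (x - 1); rewrite sqrrB1; lra.
- exact: cvg_cst.
- rewrite -[X in _ --> X](mulr0 (normal_peak (1 : R) * expR 1)).
  under eq_fun do rewrite mulrA.
  by apply: cvgM; [exact: cvg_cst | exact: cvgr_expR].
Qed.

(* [phi w] is the integral of [u * phi u] over the tail [u >= w]. *)
Lemma mills_upper w : 0 <= w -> w * Qtail w <= phi w.
Proof.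
move=> w0.
have cphi : continuous phi by apply: continuous_normal_pdf; rewrite oner_eq0.
have cg : continuous (fun u : R => u * phi u).
  by move=> x; apply: cvgM; [exact: cvg_id|exact: cphi].
have Nd (x : R) : is_derive x 1 (fun u : R => - phi u) (x * phi x).
  apply: (is_derive_eq (is_deriveN (is_derive_stdnormal_pdf x))).
  by rewrite mulNr opprK.
have mg : measurable_fun [set: R] (fun u : R => u * phi u).
  by apply: measurable_funM => //; exact: measurable_normal_pdf.
have ge0 x : w <= x -> 0 <= x * phi x.
  by move=> wx; rewrite mulr_ge0 ?normal_pdf_ge0// (le_trans w0).
have E : (\int[mu]_(x in `[w, +oo[) (x * phi x)%:E = 0%:E - (- phi w)%:E)%E.
  apply: (@ge0_continuous_FTC2y R (fun u => u * phi u) (fun u => - phi u)) => //.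
  - exact: continuous_subspaceT.
  - by rewrite -[X in _ --> X]oppr0; apply: cvgN; exact: stdnormal_pdf_cvg0.
  - by apply: cvg_at_right_filter; apply: cvgN; exact: cphi.
  - by move=> x _; rewrite derive1E; exact: (@derive_val _ _ _ _ _ _ _ (Nd x)).
have ig : mu.-integrable `[w, +oo[ (EFin \o (fun u : R => u * phi u)).
  apply/integrableP; split.
    by apply/measurable_EFinP; exact: measurable_funTS.
  have e : (\int[mu]_(x in `[w, +oo[) `|(x * phi x)%:E| =
            \int[mu]_(x in `[w, +oo[) (x * phi x)%:E)%E.
    apply: eq_integral => x; rewrite inE/= in_itv/= andbT => wx.
    by rewrite ger0_norm ?ge0.
  rewrite [X in (X < _)%E]e.
  by rewrite E ltry.
rewrite /Qtail -RintegralZl//; last by apply: integrable_stdnormal_pdf; exact: measurable_itv.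
apply: (@le_trans _ _ (\int[mu]_(x in `[w, +oo[) (x * phi x))%R).
  apply: le_Rintegral => //.
  - have iphi := integrable_stdnormal_pdf (measurable_itv `[w, +oo[).
    by refine (integrableZl _ w iphi); exact: measurable_itv.
  - move=> x/=; rewrite in_itv/= andbT => wx.
    by rewrite ler_wpM2r ?normal_pdf_ge0.
by rewrite /Rintegral E/= sub0r opprK.
Qed.

End Gaussian.

(** * Solutions of Stein's equation for half-lines *)

Section Stein.
Context {R : realType}.
Notation phi := (normal_pdf (0 : R) 1).
Implicit Types (s t u v w z : R).

Lemma Qtail_surj (e : R) : 0 < e < 1 -> exists t : R, Qtail t = e.
Proof.
move=> /andP[e0 e1].
pose p := normal_peak (1 : R).
have p0 : 0 < p by rewrite normal_peak_gt0// oner_eq0.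
have small (d : R) : 0 < d -> exists w : R, 0 < w /\ Qtail w <= d.
  (* [mills_upper] and the peak bound give [w * Qtail w <= p], so [w = p / d] works. *)
  move=> d0; exists (p / d); split; first by rewrite divr_gt0.
  have w0 : 0 < p / d by rewrite divr_gt0.
  have := mills_upper (ltW w0).
  have : phi (p / d) <= p by apply: normal_pdf_ub; rewrite oner_eq0.
  move=> h1 h2; have h3 := le_trans h2 h1.
  by rewrite -(ler_pM2l w0) (le_trans h3)// -mulrA mulVf ?mulr1// gt_eqF.
have [a [a0 ha]] := small _ e0.
have [b [b0 hb]] : exists w : R, 0 < w /\ Qtail w <= 1 - e by apply: small; rewrite subr_gt0.
have ab : - b <= a by lra.
have cQ : {within `[- b, a], continuous (@Qtail R)}.
  apply: continuous_subspaceT => x.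
  apply: differentiable_continuous; apply/derivable1_diffP.
  exact: (@ex_derive _ _ _ _ _ _ _ (is_derive_Qtail x)).
have [|c _ hc] := @IVT R Qtail (- b) a e ab cQ; last by exists c.
have h1 := Qtail_le ab.
rewrite min_r// max_l// ha QtailN; lra.
Qed.

Lemma Qtail_teps (e : R) : 0 < e < 1 -> Qtail (teps e) = e.
Proof.
move=> /Qtail_surj[t te].
suff -> : teps e = t by [].
apply/eqP; rewrite eq_le; apply/andP; split.
- apply: ge_sup; first by exists t; rewrite /= te.
  move=> x /= h; rewrite leNgt; apply/negP => /Qtail_decr; rewrite te; lra.
- apply: ub_le_sup; last by rewrite /= te.
  exists t => x /= h; rewrite leNgt; apply/negP => /Qtail_decr; rewrite te; lra.
Qed.

Lemma teps_half : teps (2^-1 : R) = 0.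
Proof.
have /Qtail_teps h : 0 < (2^-1 : R) < 1 by apply/andP; split; lra.
move: h; rewrite -{2}Qtail0 => h.
by case: (ltgtP (teps (2^-1 : R)) 0) => // /Qtail_decr; rewrite h ltxx.
Qed.

Lemma teps_gt0 (e : R) : 0 < e < 2^-1 -> 0 < teps e.
Proof.
move=> h; rewrite ltNge; apply/negP => /Qtail_le.
rewrite Qtail_teps ?Qtail0; last by lra.
lra.
Qed.

Lemma teps_lt0 (e : R) : 2^-1 < e < 1 -> teps e < 0.
Proof.
move=> h; rewrite ltNge; apply/negP => /Qtail_le.
rewrite Qtail_teps ?Qtail0; last by lra.
lra.
Qed.

(** The density is at least its value at [|t| + 1] on all of [[t - 1, t]]. Linearity in [h] is what
    lets a bounded shift of the threshold outweigh the Berry-Esseen error. *)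
Lemma Qtail_ge_lin t : exists2 c : R, 0 < c &
  forall h, 0 <= h <= 1 -> Qtail t + c * h <= Qtail (t - h).
Proof.
exists (phi (`|t| + 1)); first exact: stdnormal_pdf_gt0.
move=> h /andP[h0 h1].
have th : t - h <= t by lra.
have [c /andP[c1 c2] hc] := MVT_real th is_derive_Qtail.
suff : phi (`|t| + 1) * h <= phi c * h by move: hc; lra.
apply: ler_wpM2r => //; rewrite !stdnormal_pdfE ler_wpM2l ?normal_peak_ge0//.
rewrite ler_expR lerN2 ler_pM2r// -[c ^+ 2](real_normK (num_real c)) ler_sqr ?nnegrE ?addr_ge0//.
have := ler_norm t; have := ler_norm (- t); rewrite normrN => ? ?.
by rewrite ler_norml; apply/andP; split; lra.
Qed.

Definition mills w : R := Qtail w / phi w.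

Lemma mills_ge0 w : 0 <= mills w.
Proof. by rewrite divr_ge0 ?Qtail_ge0 ?normal_pdf_ge0. Qed.

Lemma mulr_mills_le1 w : w * mills w <= 1.
Proof.
have [w0|w0] := leP 0 w.
  by rewrite /mills mulrA ler_pdivrMr ?stdnormal_pdf_gt0// mul1r mills_upper.
by rewrite (le_trans _ ler01)// nmulr_rle0// mills_ge0.
Qed.

(** Mills' ratio solves [g' = w g - 1], so scaled and reflected copies of it provide both branches
    of the Stein solution; [mulr_mills_le1] makes the right-hand side nonpositive. *)
Lemma is_derive_mills w : is_derive w 1 mills (w * mills w - 1).
Proof.
have p0 : phi w != 0 by rewrite gt_eqF// stdnormal_pdf_gt0.
have hQ := is_derive_Qtail w.
have hp := is_derive_stdnormal_pdf w.
have hV := is_deriveV p0 hp.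
rewrite /mills.
apply: (is_derive_eq (is_deriveM hQ hV)).
rewrite /GRing.scale/=; by field.
Qed.

Lemma mills_le (a b : R) : a <= b -> mills b <= mills a.
Proof.
move=> ab; have [c _ h] := MVT_real ab is_derive_mills.
rewrite -subr_le0 h mulr_le0_ge0// ?subr_ge0//.
by rewrite subr_le0 mulr_mills_le1.
Qed.

(** The two branches of the bounded Stein solution for the indicator of [w <= z]:
    [(1 - Phi z) Phi w / phi w] on the left and [Phi z (1 - Phi w) / phi w] on the right. Each is
    smooth on the whole line. *)
Definition stein_l z w : R := Qtail z * mills (- w).
Definition stein_r z w : R := (1 - Qtail z) * mills w.

Lemma stein_lr z w : stein_l (- z) (- w) = stein_r z w.
Proof. by rewrite /stein_l /stein_r QtailN opprK. Qed.

Lemma stein_l_z z : stein_l z z = stein_r z z.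
Proof.
rewrite /stein_l /stein_r /mills QtailN stdnormal_pdfN; ring.
Qed.

Lemma is_derive_stein_r z w :
  is_derive w 1 (stein_r z) (w * stein_r z w - (1 - Qtail z)).
Proof.
have h := is_derive_mills w.
by apply: is_derive_eq; rewrite /stein_r/= /GRing.scale/=; ring.
Qed.

Lemma is_derive_stein_l z w :
  is_derive w 1 (stein_l z) (w * stein_l z w + Qtail z).
Proof.
have h := is_derive_mills (- w).
have hN : is_derive w 1 (fun x : R => - x) (- 1) by apply: is_derive_eq.
have hc : is_derive w 1 (mills \o (fun x : R => - x)) (- (- w * mills (- w) - 1)).
  by apply: is_derive_eq; rewrite ?mulrN1 ?mulN1r.
rewrite /stein_l.
by apply: (is_derive_eq (is_deriveZ _ _)); rewrite /GRing.scale/=; ring.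
Qed.

Lemma stein_r_ge0 z w : 0 <= stein_r z w.
Proof. by rewrite mulr_ge0 ?mills_ge0// subr_ge0 Qtail_le1. Qed.

(** For negative [w], monotonicity of the tail gives [1 - Qtail z <= Qtail (- w)], and the other
    factor is at most one. The bound is free of [z]. *)
Lemma stein_r_le z w : z <= w -> stein_r z w <= mills `|w|.
Proof.
move=> zw; have [w0|w0] := leP 0 w.
  by rewrite ger0_norm// ler_piMl ?mills_ge0// lerBlDr lerDl Qtail_ge0.
rewrite ltr0_norm// /stein_r /mills stdnormal_pdfN mulrA ler_pM2r; last first.
  by rewrite invr_gt0 stdnormal_pdf_gt0.
rewrite QtailN (@le_trans _ _ (1 - Qtail z))//.
  by rewrite ler_piMr ?subr_ge0 ?Qtail_le1.
by rewrite lerD2l lerN2 Qtail_le.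
Qed.


Lemma stein_l_ge0 z w : 0 <= stein_l z w.
Proof. by rewrite -[z]opprK -[w]opprK stein_lr stein_r_ge0. Qed.

Lemma stein_l_le z w : w <= z -> stein_l z w <= mills `|w|.
Proof.
move=> wz; have := @stein_r_le (- z) (- w).
by rewrite lerN2 normrN -stein_lr !opprK; exact.
Qed.

(** * Estimates for Stein's differential equation on one side of the kink *)

Section stein_half.
Variables (K c : R) (g : R -> R) (A : set R).
Hypothesis Ac : forall a b x, A a -> A b -> a <= x <= b -> A x.
Hypothesis gd : forall w : R, is_derive w 1 g (w * g w + c).
Hypothesis gK : forall w, A w -> `|g w| <= K.
Hypothesis gw1 : forall w, A w -> `|w * g w| <= 1.
Hypothesis c1 : `|c| <= 1.

Lemma stein_half_lip a b : A a -> A b -> `|g b - g a| <= 2 * `|b - a|.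
Proof.
wlog ab : a b / a <= b => [H Aa Ab|Aa Ab].
  have [/H->//|/ltW/H] := leP a b.
  by rewrite distrC (distrC b); exact.
have [x xab ->] := MVT_real ab gd.
rewrite normrM ler_wpM2r//.
have := gw1 (Ac Aa Ab xab); have := ler_normD (x * g x) c; move: c1; lra.
Qed.

Lemma stein_half_Mlip a b : A a -> A b ->
  `|b * g b - a * g a| <= (K + 2 * `|a| + 2 * `|b - a|) * `|b - a|.
Proof.
move=> Aa Ab.
have -> : b * g b - a * g a = (b - a) * g b + a * (g b - g a) by ring.
have h1 : `|(b - a) * g b| <= K * `|b - a|.
  by rewrite normrM mulrC ler_wpM2r ?gK.
have h2 : `|a * (g b - g a)| <= 2 * `|a| * `|b - a|.
  rewrite normrM (_ : 2 * `|a| * `|b - a| = `|a| * (2 * `|b - a|)); last by ring.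
  by rewrite ler_wpM2l// stein_half_lip.
have := ler_normD ((b - a) * g b) (a * (g b - g a)).
have := mulr_ge0 (normr_ge0 (b - a)) (normr_ge0 (b - a)).
lra.
Qed.

(** One mean value step suffices: the constant [c] cancels from [g'(t) - g'(a)], and
    [stein_half_Mlip] bounds what remains. *)
Lemma stein_half_taylor a b : A a -> A b ->
  `|g b - g a - (b - a) * (a * g a + c)| <=
  (K + 2 * `|a| + 2 * `|b - a|) * (b - a) ^+ 2.
Proof.
have main x y : A a -> A b -> x <= y -> ((x = a) /\ (y = b) \/ (x = b) /\ (y = a)) ->
    `|g b - g a - (b - a) * (a * g a + c)| <=
    (K + 2 * `|a| + 2 * `|b - a|) * (b - a) ^+ 2.
  move=> Aa Ab xy xyab.
  have [t txy gt] := MVT_real xy gd.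
  have At : A t by case: xyab => -[xe ye]; apply: (Ac _ _ txy); rewrite ?xe ?ye.
  have -> : g b - g a - (b - a) * (a * g a + c) = (b - a) * (t * g t - a * g a).
    have -> : g b - g a = (b - a) * (t * g t + c).
      by case: xyab gt => -[-> ->]; lra.
    ring.
  have ta : `|t - a| <= `|b - a|.
    case: xyab txy => -[-> ->] /andP[h1 h2].
      by rewrite !ger0_norm ?subr_ge0 ?(le_trans h1)// lerD2r.
    by rewrite !ler0_norm ?subr_le0 ?(le_trans h1)// lerN2 lerD2r.
  rewrite normrM -(real_normK (num_real (b - a))) expr2 mulrCA ler_wpM2l//.
  apply: le_trans (stein_half_Mlip Aa At) _.
  have K0 : 0 <= K by apply: le_trans (gK Aa).
  apply: ler_pM => //; first by rewrite !addr_ge0// mulr_ge0.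
  by rewrite lerD2l ler_pM2l.
move=> Aa Ab; have [h|/ltW h] := leP a b; first by apply: (main a b) => //; left.
by apply: (main b a) => //; right.
Qed.

End stein_half.

Definition stein_sol z w : R := if w <= z then stein_l z w else stein_r z w.
(** Read off from Stein's equation instead of differentiated, so that the equation also holds at
    [w = z], where the derivative of [stein_sol] jumps by one. *)
Definition stein_sol' z w : R := w * stein_sol z w + (w <= z)%R%:R - (1 - Qtail z).

Let K := mills (0 : R).

Let mK w : mills `|w| <= K.
Proof. exact: mills_le. Qed.

Let bnd_r z w : z <= w -> `|stein_r z w| <= K /\ `|w * stein_r z w| <= 1.
Proof.
move=> zw; have h := stein_r_le zw; have h0 := stein_r_ge0 z w.
rewrite [`|w * _|]normrM (ger0_norm h0); split; first exact: le_trans (mK w).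
by apply: le_trans (mulr_mills_le1 `|w|); rewrite ler_wpM2l.
Qed.

Let bnd_l z w : w <= z -> `|stein_l z w| <= K /\ `|w * stein_l z w| <= 1.
Proof.
move=> zw; have h := stein_l_le zw; have h0 := stein_l_ge0 z w.
rewrite [`|w * _|]normrM (ger0_norm h0); split; first exact: le_trans (mK w).
by apply: le_trans (mulr_mills_le1 `|w|); rewrite ler_wpM2l.
Qed.

Let lec z a b x : a <= z -> b <= z -> a <= x <= b -> x <= z.
Proof. lra. Qed.

Let gec z a b x : z <= a -> z <= b -> a <= x <= b -> z <= x.
Proof. lra. Qed.

Let Q1 z : `|Qtail z| <= 1.
Proof. by rewrite ger0_norm ?Qtail_ge0 ?Qtail_le1. Qed.

Let Q1' z : `|- (1 - Qtail z)| <= 1.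
Proof.
by rewrite normrN ger0_norm ?subr_ge0 ?Qtail_le1// lerBlDr lerDl Qtail_ge0.
Qed.

Lemma stein_solE z w : stein_sol' z w - w * stein_sol z w = (w <= z)%R%:R - (1 - Qtail z).
Proof. by rewrite /stein_sol'; ring. Qed.

Let ndr z w : is_derive w 1 (stein_r z) (w * stein_r z w + - (1 - Qtail z)).
Proof. exact: is_derive_stein_r. Qed.

Lemma stein_sol_lip z a b : `|stein_sol z b - stein_sol z a| <= 2 * `|b - a|.
Proof.
have L x y : x <= z -> y <= z -> `|stein_l z y - stein_l z x| <= 2 * `|y - x|.
  move=> xz yz.
  apply: (stein_half_lip (A := [set w | w <= z]) (@lec z) (is_derive_stein_l z) _ (Q1 z)) => //.
  by move=> w /bnd_l[].
have Rr x y : z <= x -> z <= y -> `|stein_r z y - stein_r z x| <= 2 * `|y - x|.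
  move=> xz yz.
  apply: (stein_half_lip (A := [set w | z <= w]) (@gec z) (ndr z) _ (Q1' z)) => //.
  by move=> w /bnd_r[].
wlog ab : a b / a <= b => [H|].
  by have [/H//|/ltW/H] := leP a b; rewrite distrC (distrC a).
rewrite /stein_sol; case: (leP a z) => az; case: (leP b z) => bz.
- exact: L.
- have -> : stein_r z b - stein_l z a = (stein_r z b - stein_r z z) + (stein_l z z - stein_l z a).
    by rewrite stein_l_z; ring.
  have h1 := Rr _ _ (lexx z) (ltW bz); have h2 := L _ _ az (lexx z).
  apply: (le_trans (ler_normD _ _)).
  have -> : `|b - a| = `|b - z| + `|z - a|.
    by rewrite !ger0_norm ?subr_ge0// ?ltW//; ring.
  by rewrite mulrDr lerD.
- by have := lt_le_trans az (le_trans ab bz); rewrite ltxx.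
- by apply: Rr; exact: ltW.
Qed.

Let bnd z w : `|stein_sol z w| <= K /\ `|w * stein_sol z w| <= 1.
Proof.
by rewrite /stein_sol; case: (leP w z) => h; [exact: bnd_l|exact/bnd_r/ltW].
Qed.

Lemma stein_sol'_le z w : `|stein_sol' z w| <= 2.
Proof.
have [_ h] := bnd z w; rewrite /stein_sol' -addrA.
have h2 : `|(w <= z)%R%:R - (1 - Qtail z)| <= 1.
  have := Qtail_ge0 z; have := Qtail_le1 z; rewrite ler_norml; case: (w <= z) => /=; lra.
by have := ler_normD (w * stein_sol z w) ((w <= z)%R%:R - (1 - Qtail z)); lra.
Qed.

(** If [v] and [v + s] lie on the same side of [z], this is Taylor's formula for one branch.
    Otherwise [|v - z| <= |s|], and the Lipschitz bounds leave [2 |s| + 2 |s|]. The indicator is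
    kept because concentration makes its probability small. *)
Lemma stein_sol_taylor z v s :
  `|stein_sol z (v + s) - stein_sol z v - s * stein_sol' z v| <=
  (mills 0 + 2 * `|v| + 2 * `|s|) * s ^+ 2 + 4 * `|s| * (`|v - z| <= `|s|)%R%:R.
Proof.
have K0 : 0 <= mills (0 : R) by exact: mills_ge0.
have sE : s = (v + s) - v by ring.
have pos : 0 <= (mills 0 + 2 * `|v| + 2 * `|s|) * s ^+ 2.
  by rewrite mulr_ge0 ?sqr_ge0// !addr_ge0// mulr_ge0.
have pos' : 0 <= 4 * `|s| * (`|v - z| <= `|s|)%R%:R by rewrite !mulr_ge0.
have cross : `|v - z| <= `|s| ->
  `|stein_sol z (v + s) - stein_sol z v - s * stein_sol' z v| <=
  (mills 0 + 2 * `|v| + 2 * `|s|) * s ^+ 2 + 4 * `|s| * (`|v - z| <= `|s|)%R%:R.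
  move=> h; rewrite h mulr1 ler_wpDl//.
  have h1 := stein_sol_lip z v (v + s); rewrite addrAC subrr add0r in h1.
  have h2 : `|s * stein_sol' z v| <= 2 * `|s|.
    by rewrite normrM mulrC ler_wpM2r ?stein_sol'_le.
  by have := ler_normB (stein_sol z (v + s) - stein_sol z v) (s * stein_sol' z v); lra.
have [vz|vz] := leP v z; have [vsz|vsz] := leP (v + s) z.
- apply: ler_wpDr => //; rewrite /stein_sol' /stein_sol vz vsz.
  have := @stein_half_taylor K (Qtail z) (stein_l z) [set w | w <= z]
    (@lec z) (is_derive_stein_l z) _ _ (Q1 z) v (v + s) vz vsz.
  rewrite -sE (_ : v * stein_l z v + 1%:R - (1 - Qtail z) = v * stein_l z v + Qtail z); last by ring.
  by apply => w /bnd_l[].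
- apply: cross; rewrite ler0_norm ?subr_le0// gtr0_norm; lra.
- apply: cross; rewrite gtr0_norm ?subr_gt0// ltr0_norm; lra.
- apply: ler_wpDr => //; rewrite /stein_sol' /stein_sol (leNgt v) vz (leNgt (v + s)) vsz/=.
  have := @stein_half_taylor K (- (1 - Qtail z)) (stein_r z) [set w | z <= w]
    (@gec z) (ndr z) _ _ (Q1' z) v (v + s) (ltW vz) (ltW vsz).
  rewrite -sE addr0.
  by apply => w /bnd_r[].
Qed.

Lemma stein_sol'_lip z v s :
  `|stein_sol' z (v + s) - stein_sol' z v| <=
  (mills 0 + 2 * `|v| + 2 * `|s|) * `|s| + 4 * (`|v - z| <= `|s|)%R%:R.
Proof.
have K0 : 0 <= mills (0 : R) by exact: mills_ge0.
have sE : s = (v + s) - v by ring.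
have pos : 0 <= (mills 0 + 2 * `|v| + 2 * `|s|) * `|s|.
  by rewrite mulr_ge0// !addr_ge0// mulr_ge0.
have cross : `|v - z| <= `|s| ->
  `|stein_sol' z (v + s) - stein_sol' z v| <=
  (mills 0 + 2 * `|v| + 2 * `|s|) * `|s| + 4 * (`|v - z| <= `|s|)%R%:R.
  move=> h; rewrite h mulr1 ler_wpDl//.
  have := stein_sol'_le z v; have := stein_sol'_le z (v + s).
  by have := ler_normB (stein_sol' z (v + s)) (stein_sol' z v); lra.
have [vz|vz] := leP v z; have [vsz|vsz] := leP (v + s) z.
- apply: ler_wpDr => //.
  rewrite /stein_sol' /stein_sol vz vsz.
  have := @stein_half_Mlip K (Qtail z) (stein_l z) [set w | w <= z]
    (@lec z) (is_derive_stein_l z) _ _ (Q1 z) v (v + s) vz vsz.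
  rewrite -sE (_ : _ - _ - (_ - _) = (v + s) * stein_l z (v + s) - v * stein_l z v); last by ring.
  by apply => w /bnd_l[].
- apply: cross; rewrite ler0_norm ?subr_le0// gtr0_norm; lra.
- apply: cross; rewrite gtr0_norm ?subr_gt0// ltr0_norm; lra.
- apply: ler_wpDr => //.
  rewrite /stein_sol' /stein_sol (leNgt v) vz (leNgt (v + s)) vsz/=.
  have := @stein_half_Mlip K (- (1 - Qtail z)) (stein_r z) [set w | z <= w]
    (@gec z) (ndr z) _ _ (Q1' z) v (v + s) (ltW vz) (ltW vsz).
  rewrite -sE (_ : _ - _ - (_ - _) = (v + s) * stein_r z (v + s) - v * stein_r z v); last by ring.
  by apply => w /bnd_r[].
Qed.

End Stein.

(** * A Berry-Esseen bound for bounded summands *)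

Lemma ler_nat_of_bool (R : realType) (P Q : bool) :
  (P -> Q) -> P%:R <= Q%:R :> R.
Proof. by case: P => [->//|_]; rewrite ler0n. Qed.

Section ProductExpectation.
Context {R : realType} {I Y : finType}.
Variable p : I -> Y -> R.
Implicit Types (F G : {ffun I -> Y} -> R) (y : {ffun I -> Y}).

Definition pexp F : R := \sum_(y : {ffun I -> Y}) (\prod_i p i (y i)) * F y.

Definition upd (i : I) (u : Y) y : {ffun I -> Y} :=
  [ffun j => if j == i then u else y j].

Lemma pexpD F G : pexp (fun y => F y + G y) = pexp F + pexp G.
Proof. by rewrite /pexp -big_split/=; apply: eq_bigr => y _; rewrite mulrDr. Qed.

Lemma pexpZ (c : R) F : pexp (fun y => c * F y) = c * pexp F.
Proof. by rewrite /pexp mulr_sumr; apply: eq_bigr => y _; rewrite mulrCA. Qed.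

Lemma pexpB F G : pexp (fun y => F y - G y) = pexp F - pexp G.
Proof. by rewrite /pexp -sumrB; apply: eq_bigr => y _; rewrite mulrBr. Qed.

Lemma pexp_sum (J : finType) (H : J -> {ffun I -> Y} -> R) :
  pexp (fun y => \sum_j H j y) = \sum_j pexp (H j).
Proof.
rewrite /pexp exchange_big/=; apply: eq_bigr => y _.
by rewrite mulr_sumr.
Qed.

Lemma eq_pexp F G : (forall y, F y = G y) -> pexp F = pexp G.
Proof. by move=> FG; apply: eq_bigr => y _; rewrite FG. Qed.

Hypothesis pd : forall i, is_dist (p i).

Lemma prod_dist_ge0 y : 0 <= \prod_i p i (y i).
Proof. by apply: prodr_ge0 => i _; have [+ _] := pd i; apply. Qed.

Lemma le_pexp F G : (forall y, F y <= G y) -> pexp F <= pexp G.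
Proof. by move=> FG; apply: ler_sum => y _; rewrite ler_wpM2l ?prod_dist_ge0. Qed.

Lemma pexp_cst (c : R) : pexp (fun=> c) = c.
Proof.
rewrite /pexp -mulr_suml -(bigA_distr_bigA p) big1 ?mul1r// => i _.
by have [] := pd i.
Qed.

Lemma ler_norm_pexp F : `|pexp F| <= pexp (fun y => `|F y|).
Proof.
apply: le_trans (ler_norm_sum _ _ _) _; apply: ler_sum => y _.
by rewrite normrM ger0_norm ?prod_dist_ge0.
Qed.

Lemma upd_same i u y : upd i u y i = u.
Proof. by rewrite ffunE eqxx. Qed.

(** The weight of a pair of a fresh letter and a word is invariant under the involution exchanging
    that letter with coordinate [i]. After the exchange the fresh letter sums out to one. *)
Lemma pexp_resample i F :
  pexp (fun y => \sum_u p i u * F (upd i u y)) = pexp F.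
Proof.
have [_ p1] := pd i.
transitivity (\sum_(uy : Y * {ffun I -> Y}) p i uy.1 * (\prod_j p j (uy.2 j)) * F (upd i uy.1 uy.2)).
  rewrite -(pair_bigA _ (fun u y => p i u * (\prod_j p j (y j)) * F (upd i u y)))/=.
  rewrite exchange_big/=; apply: eq_bigr => y _.
  by rewrite mulr_sumr; apply: eq_bigr => u _; rewrite mulrA (mulrC (\prod__ _)).
pose h (uy : Y * {ffun I -> Y}) := (uy.2 i, upd i uy.1 uy.2).
have hK : involutive h.
  move=> [u y]; rewrite /h/= upd_same; congr pair.
  by apply/ffunP => j; rewrite !ffunE; case: eqP => // ->.
rewrite (reindex_inj (inv_inj hK))/=.
transitivity (\sum_(uy : Y * {ffun I -> Y}) p i uy.1 * (\prod_j p j (uy.2 j)) * F uy.2).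
  apply: eq_bigr => -[u y] _ /=; congr (_ * _).
    rewrite [in LHS](bigD1 i)//= [in RHS](bigD1 i)//= upd_same mulrCA.
    do 2 congr (_ * _).
    by apply: eq_bigr => j ji; rewrite ffunE (negbTE ji).
  by congr F; apply/ffunP => j; rewrite !ffunE; case: eqP => // ->.
rewrite -(pair_bigA _ (fun u y => p i u * (\prod_j p j (y j)) * F y))/=.
rewrite exchange_big/=; apply: eq_bigr => y _.
by rewrite -!mulr_suml p1 mul1r.
Qed.

Lemma pexp_indep i (a : Y -> R) F : (forall u y, F (upd i u y) = F y) ->
  pexp (fun y => a (y i) * F y) = (\sum_u p i u * a u) * pexp F.
Proof.
move=> Fi; rewrite -(pexp_resample i) -pexpZ; apply: eq_pexp => y.
by rewrite mulr_suml; apply: eq_bigr => u _; rewrite upd_same Fi mulrA.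
Qed.

Lemma pexp_coord i (a : Y -> R) : pexp (fun y => a (y i)) = \sum_u p i u * a u.
Proof.
rewrite -[RHS]mulr1 -(pexp_cst 1) -pexp_indep//.
by apply: eq_pexp => y; rewrite mulr1.
Qed.

Definition psum (a : I -> Y -> R) y : R := \sum_i a i (y i).

Definition psum' (a : I -> Y -> R) i y : R := \sum_(j | j != i) a j (y j).

Lemma psumD1 a i y : psum a y = psum' a i y + a i (y i).
Proof. by rewrite /psum (bigD1 i)//= addrC. Qed.

Lemma psum'_upd a i u y : psum' a i (upd i u y) = psum' a i y.
Proof. by apply: eq_bigr => j ji; rewrite ffunE (negbTE ji). Qed.

Section Centered.
Variable a : I -> Y -> R.
Hypothesis a0 : forall i, \sum_u p i u * a i u = 0.

(** The first move of Stein's method: [f (psum' a i y)] ignores coordinate [i] and [a i] is centred,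
    so subtracting it changes nothing. *)
Lemma pexp_psumM (f : R -> R) :
  pexp (fun y => psum a y * f (psum a y)) =
  \sum_i pexp (fun y => a i (y i) * (f (psum a y) - f (psum' a i y))).
Proof.
under eq_pexp do rewrite mulr_suml.
rewrite pexp_sum; apply: eq_bigr => i _.
under [RHS]eq_pexp do rewrite mulrBr.
rewrite pexpB (pexp_indep (a i) (F := fun y => f (psum' a i y))) ?a0 ?mul0r ?subr0//.
by move=> u y; rewrite psum'_upd.
Qed.

Lemma pexp_psum_sqr :
  pexp (fun y => psum a y ^+ 2) = \sum_i \sum_u p i u * a i u ^+ 2.
Proof.
(* This is the case [f = id] of [pexp_psumM], where the increment is the summand itself. *)
rewrite (eq_pexp (G := fun y => psum a y * idfun (psum a y))); last first.
  by move=> y; rewrite expr2.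
rewrite pexp_psumM; apply: eq_bigr => i _.
rewrite -(pexp_coord i (fun u => a i u ^+ 2)); apply: eq_pexp => y/=.
by rewrite (psumD1 a i) addrAC subrr add0r expr2.
Qed.

End Centered.

Section BerryEsseen.
Variables (a : I -> Y -> R) (b : R).
Hypothesis a0 : forall i, \sum_u p i u * a i u = 0.
Hypothesis a1 : \sum_i \sum_u p i u * a i u ^+ 2 = 1.
Hypothesis ab : forall i u, `|a i u| <= b.
Hypothesis b01 : 0 < b <= 1.

Let s2 i := \sum_u p i u * a i u ^+ 2.

Let s2_ge0 i : 0 <= s2 i.
Proof. by apply: sumr_ge0 => u _; rewrite mulr_ge0 ?sqr_ge0//; have [+ _] := pd i. Qed.

Lemma pexp_norm_psum_le1 : pexp (fun y => `|psum a y|) <= 1.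
Proof.
apply: (@le_trans _ _ (pexp (fun y => 2^-1 * 1 + 2^-1 * psum a y ^+ 2))).
  apply: le_pexp => y; have := sqr_ge0 (`|psum a y| - 1).
  rewrite sqrrB1 real_normK ?num_real//; lra.
rewrite pexpD !pexpZ pexp_cst pexp_psum_sqr// a1; lra.
Qed.

(** The centred squares [e] have total variance at most the sum of fourth moments, hence at most
    [b^2]. The weighted inequality [|x| <= b / 2 + x^2 / (2 b)] then yields a first moment of at
    most [b]. *)
Lemma pexp_sqr_conc : pexp (fun y => `|1 - \sum_i a i (y i) ^+ 2|) <= b.
Proof.
have /andP[b0 _] := b01.
pose e i u := a i u ^+ 2 - s2 i.
have e0 i : \sum_u p i u * e i u = 0.
  under eq_bigr do rewrite mulrBr.
  by rewrite sumrB -mulr_suml (pd i).2 mul1r subrr.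
have h : pexp (fun y => psum e y ^+ 2) <= b ^+ 2.
  rewrite pexp_psum_sqr// -[leRHS]mulr1 -a1 mulr_sumr; apply: ler_sum => i _.
  apply: (@le_trans _ _ (\sum_u p i u * a i u ^+ 4)).
    rewrite -subr_ge0 -sumrB.
    rewrite (_ : \sum_u _ = s2 i * s2 i); first by rewrite mulr_ge0.
    transitivity (\sum_u (2 * s2 i * (p i u * a i u ^+ 2) - s2 i ^+ 2 * p i u)).
      by apply: eq_bigr => u _; rewrite /e; ring.
    by rewrite sumrB -!mulr_sumr (pd i).2 -/(s2 i); ring.
  rewrite mulr_sumr; apply: ler_sum => u _.
  rewrite [leRHS]mulrCA ler_wpM2l ?(pd i).1// (exprD _ 2 2) ler_wpM2r ?sqr_ge0//.
  by rewrite -(real_normK (num_real (a i u))) lerXn2r ?nnegrE// ltW.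
apply: (@le_trans _ _ (pexp (fun y => b / 2 * 1 + (b^-1 / 2) * psum e y ^+ 2))).
  apply: le_pexp => y.
  have -> : 1 - \sum_i a i (y i) ^+ 2 = - psum e y.
    by rewrite /psum sumrB -/(s2 _) (_ : \sum_i s2 i = 1)// opprB.
  rewrite normrN; set x := psum e y.
  have : 0 <= b^-1 * (`|x| - b) ^+ 2 by rewrite mulr_ge0 ?sqr_ge0// invr_ge0 ltW.
  have -> : b^-1 * (`|x| - b) ^+ 2 = b^-1 * `|x| ^+ 2 - 2 * `|x| + b.
    by field; rewrite gt_eqF.
  rewrite real_normK ?num_real//; lra.
rewrite pexpD !pexpZ pexp_cst.
have : b^-1 / 2 * pexp (fun y => psum e y ^+ 2) <= b^-1 / 2 * b ^+ 2.
  by rewrite ler_wpM2l// divr_ge0// invr_ge0 ltW.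
have -> : b^-1 / 2 * b ^+ 2 = b / 2 by field; rewrite gt_eqF.
lra.
Qed.

(* Stein's identity for the clipped identity: its increments over one summand
   equal that summand as long as the sum stays in the window. *)
Lemma concentration (z c : R) : 0 <= c ->
  pexp (fun y => (`|psum a y - z| <= c)%R%:R) <= c + 2 * b.
Proof.
move=> c0; have /andP[b0 _] := b01.
(* The clip level leaves a margin of one summand: if the full sum is within [c] of [z], the sum
   without one term still lies where [f] is affine. *)
pose f (w : R) := maxr (- (c + b)) (minr (c + b) (w - z)).
have fle w : `|f w| <= c + b.
  rewrite /f ler_norml /maxr /minr; repeat case: ifP; move=> *; apply/andP; split; lra.
have fmono v w : v <= w -> f v <= f w.
  move=> vw; rewrite /f ge_max le_max lexx/= le_max; apply/orP; right.
  by rewrite le_min !ge_min lexx/= lerD2r vw orbT.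
have fin w : `|w - z| <= c + b -> f w = w - z.
  by rewrite ler_norml => /andP[h1 h2]; rewrite /f min_r// max_r.
have h1 : pexp (fun y => psum a y * f (psum a y)) <= c + b.
  apply: (@le_trans _ _ (pexp (fun y => (c + b) * `|psum a y|))).
    apply: le_pexp => y; apply: le_trans (ler_norm _) _.
    by rewrite normrM mulrC ler_wpM2r.
  by rewrite pexpZ -[leRHS]mulr1 ler_wpM2l ?pexp_norm_psum_le1 ?addr_ge0// ltW.
have h2 : pexp (fun y => (`|psum a y - z| <= c)%R%:R * \sum_i a i (y i) ^+ 2) <=
          pexp (fun y => psum a y * f (psum a y)).
  under eq_pexp do rewrite mulr_sumr.
  rewrite pexp_sum pexp_psumM//; apply: ler_sum => i _; apply: le_pexp => y.
  rewrite (psumD1 a i); set v := psum' a i y; set s := a i (y i).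
  have sb : `|s| <= b by exact: ab.
  have [h|_] := leP `|v + s - z| c; rewrite ?mul1r ?mul0r.
    rewrite !fin; first by rewrite expr2 (_ : _ - _ - _ = s)//; ring.
      rewrite (_ : v - z = v + s - z - s); last by ring.
      by apply: le_trans (ler_normB _ _) _; rewrite lerD.
    by apply: le_trans h _; rewrite lerDl ltW.
  have [s0|s0] := leP 0 s.
    by rewrite mulr_ge0// subr_ge0 fmono// lerDl.
  by rewrite nmulr_rge0// subr_le0 fmono// gerDl ltW.
(* The indicator came weighted by the sum of squares; replacing this weight by 1 costs the last
   [b]. *)
have h3 : pexp (fun y => (`|psum a y - z| <= c)%R%:R) <=
          pexp (fun y => (`|psum a y - z| <= c)%R%:R * \sum_i a i (y i) ^+ 2) +
          pexp (fun y => `|1 - \sum_i a i (y i) ^+ 2|).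
  rewrite -pexpD; apply: le_pexp => y; case: (_ <= c); rewrite /= ?mulr1n ?mulr0n ?mul1r ?mul0r ?add0r//.
  have := ler_norm (1 - \sum_i a i (y i) ^+ 2); lra.
have := pexp_sqr_conc; lra.
Qed.

(** Stein's equation turns the left side into the mean of [f'(S) - S f(S)]. Splitting it with the
    weights [s2 i], which sum to one, makes each remainder proportional to [s2 i], so the bound does
    not grow with the number of summands. *)
Lemma berry_esseen (z : R) :
  `|pexp (fun y => (psum a y <= z)%R%:R) - (1 - Qtail z)| <=
  2 * (mills (0 : R) + 22) * b.
Proof.
have /andP[b0 b1] := b01.
set K := mills (0 : R).
have K0 : 0 <= K by exact: mills_ge0.
pose f := stein_sol z; pose f' := stein_sol' z.
have -> : pexp (fun y => (psum a y <= z)%R%:R) - (1 - Qtail z) =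
    \sum_i (s2 i * pexp (fun y => f' (psum a y)) -
            pexp (fun y => a i (y i) * (f (psum a y) - f (psum' a i y)))).
  rewrite sumrB -mulr_suml (_ : \sum_i s2 i = 1)// mul1r -pexp_psumM// -pexpB.
  rewrite -(pexp_cst (1 - _)) -pexpB; apply: eq_pexp => y.
  by rewrite stein_solE.
have normW' i : pexp (fun y => `|psum' a i y|) <= 1 + b.
  apply: (@le_trans _ _ (pexp (fun y => `|psum a y| + b))); last first.
    by rewrite pexpD pexp_cst lerD2r pexp_norm_psum_le1.
  apply: le_pexp => y.
  rewrite (_ : psum' a i y = psum a y - a i (y i)); last by rewrite (psumD1 a i); ring.
  by apply: le_trans (ler_normB _ _) _; rewrite lerD2l.
have conc' i : pexp (fun y => (`|psum' a i y - z| <= b)%R%:R) <= 4 * b.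
  (* Restoring the missing term widens the window from [b] to [2 * b], where [concentration] gives
     [2 * b + 2 * b]. *)
  apply: (@le_trans _ _ (pexp (fun y => (`|psum a y - z| <= 2 * b)%R%:R))); last first.
    by apply: le_trans (concentration _ _) _; lra.
  apply: le_pexp => y.
  have [h|_] := leP `|psum' a i y - z| b; last by rewrite ler0n.
  rewrite ler_nat lt0b (psumD1 a i).
  rewrite (_ : _ + _ - z = (psum' a i y - z) + a i (y i)); last by ring.
  by apply: le_trans (ler_normD _ _) _; have := ab i (y i); lra.
have bound i : `|s2 i * pexp (fun y => f' (psum a y)) -
     pexp (fun y => a i (y i) * (f (psum a y) - f (psum' a i y)))| <=
     s2 i * (2 * (K + 22) * b).
  (* [q] bounds the change of [f'] and, per unit of variance, the Taylor remainder of [f]. Its mean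
     is at most [(K + 2 + 4 b + 16) b], with 16 from the crossing term, and [b <= 1] gives 22. The
     factor 2 in the lemma counts these two uses. *)
  pose q y := (K + 2 * `|psum' a i y| + 2 * b) * b + 4 * (`|psum' a i y - z| <= b)%R%:R.
  have qupd u y : q (upd i u y) = q y by rewrite /q psum'_upd.
  have qE : pexp q <= (K + 22) * b.
    rewrite /q pexpD pexpZ.
    have -> : pexp (fun y => (K + 2 * `|psum' a i y| + 2 * b) * b) =
              (K + 2 * b) * b + 2 * b * pexp (fun y => `|psum' a i y|).
      by rewrite -pexpZ -[X in X + _]pexp_cst -pexpD; apply: eq_pexp => y; ring.
    have := conc' i; have := ler_wpM2l (ltW b0) (normW' i).
    have : b * b <= b by rewrite ler_piMr// ltW.
    lra.
  have e1 : `|pexp (fun y => f' (psum a y)) - pexp (fun y => f' (psum' a i y))| <= (K + 22) * b.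
    rewrite -pexpB; apply: le_trans (ler_norm_pexp _) _; apply: le_trans qE.
    apply: le_pexp => y; rewrite (psumD1 a i).
    apply: le_trans (stein_sol'_lip _ _ _) _; rewrite /q lerD//.
      apply: ler_pM => //; first by rewrite !addr_ge0// mulr_ge0.
      by rewrite lerD2l ler_pM2l.
    by rewrite ler_pM2l// ler_nat_of_bool// => /le_trans; exact.
  have e2 : `|s2 i * pexp (fun y => f' (psum' a i y)) -
     pexp (fun y => a i (y i) * (f (psum a y) - f (psum' a i y)))| <= s2 i * ((K + 22) * b).
    rewrite -pexp_indep; last by move=> u y; rewrite psum'_upd.
    rewrite -pexpB; apply: le_trans (ler_norm_pexp _) _.
    apply: (@le_trans _ _ (s2 i * pexp q)); last by rewrite ler_wpM2l.
    rewrite -pexp_indep//; apply: le_pexp => y; rewrite (psumD1 a i).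
    set v := psum' a i y; set s := a i (y i).
    rewrite (_ : _ - _ = - (s * (f (v + s) - f v - s * f' v))); last by ring.
    have sb : `|s| <= b by exact: ab.
    rewrite normrN normrM.
    apply: (@le_trans _ _ (`|s| * ((K + 2 * `|v| + 2 * `|s|) * s ^+ 2 +
      4 * `|s| * (`|v - z| <= `|s|)%R%:R))).
      by rewrite ler_wpM2l// stein_sol_taylor.
    rewrite -(real_normK (num_real s)).
    have -> : `|s| * ((K + 2 * `|v| + 2 * `|s|) * `|s| ^+ 2 + 4 * `|s| * (`|v - z| <= `|s|)%R%:R) =
      `|s| ^+ 2 * ((K + 2 * `|v| + 2 * `|s|) * `|s| + 4 * (`|v - z| <= `|s|)%R%:R) by ring.
    rewrite ler_wpM2l ?sqr_ge0// /q lerD//.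
      apply: ler_pM => //; first by rewrite !addr_ge0// mulr_ge0.
      by rewrite lerD2l ler_pM2l.
    by rewrite ler_pM2l// ler_nat_of_bool// => /le_trans; exact.
  rewrite (_ : _ - _ = s2 i * (pexp (fun y => f' (psum a y)) - pexp (fun y => f' (psum' a i y))) +
    (s2 i * pexp (fun y => f' (psum' a i y)) -
     pexp (fun y => a i (y i) * (f (psum a y) - f (psum' a i y))))); last by ring.
  apply: le_trans (ler_normD _ _) _.
  rewrite normrM (ger0_norm (s2_ge0 i)).
  have := ler_wpM2l (s2_ge0 i) e1; lra.
apply: le_trans (ler_norm_sum _ _ _) _.
apply: le_trans (ler_sum _ (fun i _ => bound i)) _.
by rewrite -mulr_suml (_ : \sum_i s2 i = 1)// mul1r.
Qed.

End BerryEsseen.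
End ProductExpectation.

(** * Hoffman's error bound on the simplex *)

Lemma continuous_sum {R : realType} {T : topologicalType} (I : Type) (r : seq I)
    (p : pred I) (f : I -> T -> R) :
  (forall i, p i -> continuous (f i)) ->
  continuous (fun t => \sum_(i <- r | p i) f i t).
Proof.
move=> cf; elim: r => [|i r IH].
  rewrite (_ : (fun _ => _) = cst 0); first exact: cst_continuous.
  by apply/funext => t; rewrite big_nil.
rewrite (_ : (fun _ => _) = fun t => (if p i then f i t else 0) + \sum_(i <- r | p i) f i t).
  move=> t; apply: cvgD; last exact: IH.
  by case: ifP => [/cf|_]; [exact|exact: cvg_cst].
by apply/funext => t; rewrite big_cons; case: ifP => //; rewrite add0r.
Qed.

Lemma continuous_mulr_cst {R : realType} {T : topologicalType} (g : T -> R) (c : R) :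
  continuous g -> continuous (fun t => g t * c).
Proof. by move=> cg t; apply: cvgM; [exact: cg|exact: cvg_cst]. Qed.

Lemma continuous_norm_subr {R : realType} {T : topologicalType} (g : T -> R) (c : R) :
  continuous g -> continuous (fun t => `|g t - c|).
Proof.
by move=> cg t; apply: cvg_norm; apply: cvgB; [exact: cg|exact: cvg_cst].
Qed.

Lemma continuous_norm_comp {R : realType} {T : topologicalType} (g : T -> R) :
  continuous g -> continuous (fun t => `|g t|).
Proof. by move=> cg t; apply: cvg_norm; exact: cg. Qed.

Lemma continuous_add {R : realType} {T : topologicalType} (g h : T -> R) :
  continuous g -> continuous h -> continuous (fun t => g t + h t).
Proof. by move=> cg ch t; apply: cvgD; [exact: cg|exact: ch]. Qed.

Lemma big_option_sum {R : realType} (J : finType) (f : option J -> R) :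
  \sum_j f j = f None + \sum_j f (Some j).
Proof.
rewrite (bigD1 None)//=; congr (_ + _).
rewrite (reindex_omap Some id) => [|[]//].
by apply: eq_bigl => j; rewrite eqxx.
Qed.

Section Hoffman.
Context {R : realType} {X : finType}.
Implicit Types (P s : X -> R) (F : {set X}).

Definition supported P F := forall x, x \notin F -> P x = 0.

Section Residual.
Context {J : finType}.
Variables (A : J -> X -> R) (b : J -> R).

Definition residual P : R := \sum_j `|\sum_x P x * A j x - b j|.

Definition solution P := is_dist P /\ forall j, \sum_x P x * A j x = b j.

Lemma residual_ge0 P : 0 <= residual P.
Proof. exact: sumr_ge0. Qed.

Lemma residual_eq0 P : residual P = 0 -> forall j, \sum_x P x * A j x = b j.
Proof.
move=> /psumr_eq0P h j; apply/eqP; rewrite -subr_eq0 -normr_eq0.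
by rewrite h.
Qed.

Lemma dist_le1 P x : is_dist P -> 0 <= P x <= 1.
Proof.
move=> [P0 P1]; rewrite P0/= -P1 (bigD1 x)//= lerDl.
by apply: sumr_ge0 => i _.
Qed.

Let T : topologicalType := prod_topology (fun _ : X => R).

Let continuous_coord x : continuous (fun P : T => P x).
Proof. exact: (@proj_continuous _ (fun _ : X => R) x). Qed.

Let continuous_lin (a : X -> R) : continuous (fun P : T => \sum_x P x * a x).
Proof.
apply: continuous_sum => x _; apply: continuous_mulr_cst.
exact: continuous_coord.
Qed.

(** Total mass and support enter as penalties, so that a continuous function is minimised over a
    compact cube. Its minimum is below every residual on the face, hence zero. *)
Lemma face_solution F :
  (forall e : R, 0 < e -> exists P, [/\ is_dist P, supported P F & residual P < e]) ->
  exists2 P, solution P & supported P F.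
Proof.
move=> H.
pose cube := [set P : T | forall x, `[0, 1]%classic (P x)].
have cubeK : compact cube.
  by apply: (@tychonoff X (fun _ => R) (fun=> `[0, 1]%classic)) => x; exact: segment_compact.
pose phi (P : T) : R := residual P + (`|\sum_x P x * 1 - 1| + \sum_(x | x \notin F) `|P x|).
have cphi : continuous phi.
  apply: continuous_add; [|apply: continuous_add].
  - apply: continuous_sum => j _; apply: continuous_norm_subr; exact: continuous_lin.
  - apply: continuous_norm_subr; exact: continuous_lin.
  - apply: continuous_sum => x _; apply: continuous_norm_comp; exact: continuous_coord.
have in_cube P : is_dist P -> cube P.
  by move=> dP x /=; rewrite in_itv/= dist_le1.
have [P1 [dP1 _ _]] := H _ ltr01.
have [|c cc cmin] := @compact_EVT_min T R phi cube _ cubeK (continuous_subspaceT cphi).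
  by exists P1; exact: in_cube.
move: cc; rewrite inE => cc.
have c0 x : 0 <= c x by have := cc x; rewrite /= in_itv/= => /andP[].
have s0 : 0 <= \sum_(x | x \notin F) `|c x| by exact: sumr_ge0.
have phi0 : phi c <= 0.
  rewrite leNgt; apply/negP => /H[P [dP sP rP]].
  have := cmin P; rewrite inE => /(_ (in_cube _ dP)).
  suff -> : phi P = residual P by rewrite leNgt rP.
  rewrite /phi; under eq_bigr do rewrite mulr1.
  rewrite dP.2 subrr normr0 add0r big1 ?addr0// => x xF.
  by rewrite sP ?normr0.
have r0 := residual_ge0 c.
have := normr_ge0 (\sum_x c x * 1 - 1); rewrite /phi in phi0 => n0.
have rc : residual c = 0 by lra.
have nc : `|\sum_x c x * 1 - 1| = 0 by lra.
have sc : \sum_(x | x \notin F) `|c x| = 0 by lra.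
exists c.
  split; last exact: residual_eq0.
  split => //; move/eqP: nc; rewrite normr_eq0 subr_eq0 => /eqP <-.
  by apply: eq_bigr => x _; rewrite mulr1.
move=> x xF; apply/eqP; rewrite -normr_eq0.
by move/psumr_eq0P: sc => ->.
Qed.

(** The constant stands in front of the alternative so that choice yields one number per face; where
    a solution exists its value 1 is arbitrary. *)
Lemma face_residual F : exists c : R, 0 < c /\
  ((exists2 s, solution s & supported s F) \/
   (forall P, is_dist P -> supported P F -> c <= residual P)).
Proof.
have [h|h] := pselect (exists2 s, solution s & supported s F).
  by exists 1; split => //; left.
apply: contrapT => H; apply: h; apply: face_solution => e e0.
apply: contrapT => h; apply: H; exists e; split => //; right => P dP sP.
by rewrite leNgt; apply/negP => rP; apply: h; exists P.
Qed.

Lemma solution_convex s s' (l : R) : 0 <= l <= 1 -> solution s -> solution s' ->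
  solution (fun x => (1 - l) * s x + l * s' x).
Proof.
move=> /andP[l0 l1] [[s0 s1] sb] [[s0' s1'] sb']; split; [split|].
- by move=> x; rewrite addr_ge0 ?mulr_ge0 ?subr_ge0.
- by rewrite big_split/= -!mulr_sumr s1 s1'; ring.
- move=> j; transitivity ((1 - l) * \sum_x s x * A j x + l * \sum_x s' x * A j x).
    by rewrite !mulr_sumr -big_split/=; apply: eq_bigr => x _; ring.
  by rewrite sb sb'; ring.
Qed.

(* The ray from a solution [s] in the face of [P] through [P] leaves that face
   at a point with smaller support, where the bound holds by induction; the
   homothety centred at [s] carries it back to [P] with the same constant. *)
Lemma hoffman : (exists s, solution s) -> exists K : R, 0 < K /\
  forall P, is_dist P -> exists2 s, solution s &
    forall x, `|P x - s x| <= K * residual P.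
Proof.
move=> [s0 s0S].
have [c Hc] := choice face_residual.
have c0 F : 0 < c F by have [] := Hc F.
(* The sum over all finitely many faces dominates every [(c F)^-1], so [K] does not depend on the
   face. *)
pose K := 1 + \sum_F (c F)^-1.
have K0 : 0 < K by rewrite ltr_pwDl// sumr_ge0// => F _; rewrite invr_ge0 ltW.
have Kc F : (c F)^-1 <= K.
  rewrite /K (bigD1 F)//= addrCA lerDl addr_ge0// sumr_ge0// => G _.
  by rewrite invr_ge0 ltW.
exists K; split => // P.
have [m] := ubnP #|[set x | P x != 0]%SET|; elim: m P => // m IH P mP dP.
set F := [set x | P x != 0]%SET in mP.
have PF : supported P F by move=> x; rewrite inE negbK => /eqP.
(* In a face without solutions the residual is at least [c F], and coordinates of distributions
   differ by at most 1, so any solution serves. *)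
have [_ [[s sS sF]|far]] := Hc F; last first.
  exists s0 => // x; apply: (@le_trans _ _ 1).
    have := dist_le1 x dP; have := dist_le1 x s0S.1.
    by rewrite ler_norml => /andP[? ?] /andP[? ?]; apply/andP; split; lra.
  apply: (@le_trans _ _ ((c F)^-1 * residual P)); last first.
    by rewrite ler_wpM2r ?residual_ge0.
  by rewrite mulrC ler_pdivlMr// mul1r far.
have [[P0 P1] [[sg0 s1] sb]] := (dP, sS).
have [/existsP[i0 i0P]|/existsPn Ps] := boolP [exists i, P i < s i]; last first.
  have Pse x : P x = s x.
    apply/eqP; rewrite -subr_eq0.
    have : \sum_x (P x - s x) = 0 by rewrite sumrB P1 s1 subrr.
    move/psumr_eq0P => ->// y _; rewrite subr_ge0 leNgt; exact: Ps.
  by exists s => // x; rewrite Pse subrr normr0 mulr_ge0 ?residual_ge0// ltW.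
(* [l x] is the parameter at which coordinate [x] vanishes along the ray from [s] through [P]; the
   smallest one marks the exit from the simplex. *)
pose l x := s x / (s x - P x).
have [i iP imin] := @arg_minP _ _ _ i0 (fun i => P i < s i) l i0P.
have di : 0 < s i - P i by rewrite subr_gt0.
have l1 : 1 <= l i by rewrite ler_pdivlMr// mul1r gerBl.
have l0 : 0 < l i by exact: lt_le_trans l1.
pose Q x := s x + l i * (P x - s x).
have dQ : is_dist Q.
  split.
    move=> x; rewrite /Q; have [h|h] := leP (s x) (P x).
      by rewrite addr_ge0// mulr_ge0 ?subr_ge0// ltW.
    have dx : 0 < s x - P x by rewrite subr_gt0.
    have := imin _ h; rewrite {2}/l ler_pdivlMr//; lra.
  by rewrite big_split/= -mulr_sumr sumrB P1 s1; ring.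
have QF x : x \notin F -> Q x = 0.
  by move=> xF; rewrite /Q PF// sF//; ring.
have Qi : Q i = 0 by rewrite /Q /l; field; rewrite gt_eqF.
have iF : i \in F.
  by apply: contraTT iP => iF; rewrite PF// sF// ltxx.
have [|s' s'S s'Q] := IH Q _ dQ.
  rewrite -ltnS (leq_trans _ mP)// ltnS; apply: proper_card.
  apply/properP; split; last by exists i => //; rewrite inE Qi eqxx.
  by apply/fintype.subsetP => x; rewrite inE; apply: contraNT => /QF ->.
have rQ : residual Q = l i * residual P.
  rewrite /residual mulr_sumr; apply: eq_bigr => j _.
  rewrite -[X in X * _](ger0_norm (ltW l0)) -normrM; congr `|_|.
  transitivity ((1 - l i) * \sum_x s x * A j x + l i * \sum_x P x * A j x - b j).
    by congr (_ - _); rewrite !mulr_sumr -big_split/=; apply: eq_bigr => x _; rewrite /Q; ring.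
  by rewrite sb; ring.
exists (fun x => (1 - (l i)^-1) * s x + (l i)^-1 * s' x).
  by apply: solution_convex => //; rewrite invr_ge0 ltW//= invf_le1.
move=> x.
have -> : P x - ((1 - (l i)^-1) * s x + (l i)^-1 * s' x) = (l i)^-1 * (Q x - s' x).
  by rewrite /Q; field; rewrite gt_eqF.
rewrite normrM ger0_norm ?invr_ge0 ?(ltW l0)// mulrC ler_pdivrMr//.
by apply: le_trans (s'Q x) _; rewrite rQ; rewrite mulrCA mulrC.
Qed.

End Residual.

(** Attainment of the infimum is solvability of the system with one extra equation, indexed by
    [None]; near-minimisers have small residual there, so [face_solution] applies. *)
Lemma solution_min {J : finType} (A : J -> X -> R) (b : J -> R) (v : X -> R) :
  (exists s, solution A b s) ->
  exists2 s, solution A b s &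
    \sum_x s x * v x = inf [set \sum_x s x * v x | s in solution A b].
Proof.
move=> [s0 s0S].
set S := [set \sum_x s x * v x | s in solution A b].
have hS : has_inf S.
  split; first by exists (\sum_x s0 x * v x); exists s0.
  exists (- \sum_x `|v x|) => _ [s sS <-].
  rewrite -sumrN; apply: ler_sum => x _.
  have /andP[h0 h1] := dist_le1 x sS.1.
  have := ler_norm (- v x); rewrite normrN => h.
  have : s x * `|v x| <= `|v x| by rewrite ler_piMl.
  have := ler_wpM2l h0 h; lra.
pose A' (j : option J) := if j is Some j then A j else v.
pose b' (j : option J) := if j is Some j then b j else inf S.
have [e e0|s [sd sb] _] := @face_solution _ A' b' [set: X].
  have [_ [s [sd sb] <-] sv] := inf_adherent e0 hS.
  exists s; split => //; first by move=> x; rewrite inE.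
  rewrite /residual big_option_sum/= [X in _ + X]big1 ?addr0; last by move=> j _; rewrite sb subrr normr0.
  rewrite ger0_norm; first by rewrite ltrBlDl.
  by rewrite subr_ge0 ge_inf//; [exact: hS.2|exists s].
exists s; last exact: (sb None).
by split => // j; exact: (sb (Some j)).
Qed.

End Hoffman.

(** * Divergences and capacity *)

Section LogInequalities.
Context {R : realType}.
Implicit Types x : R.

Lemma ln_le_subr1 x : 0 < x -> ln x <= x - 1.
Proof.
move=> x0; have := @le_ln1Dx R (x - 1).
by rewrite addrCA subrr addr0; apply; rewrite ltrBDr addNr.
Qed.

Lemma ln_ge_onemV x : 0 < x -> 1 - x^-1 <= ln x.
Proof.
move=> x0; have := ln_le_subr1 (x := x^-1); rewrite invr_gt0 => /(_ x0).
rewrite lnV ?posrE//; lra.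
Qed.

Lemma ln1D_ge x : - 2^-1 <= x -> x - 2 * x ^+ 2 <= ln (1 + x).
Proof.
move=> x2; have x0 : 0 < 1 + x by lra.
apply: le_trans (ln_ge_onemV x0).
have -> : 1 - (1 + x)^-1 = x - x ^+ 2 / (1 + x) by field; rewrite gt_eqF.
rewrite lerD2l lerN2 ler_pdivrMr//.
have := sqr_ge0 x; nra.
Qed.

Lemma norm_ln1D_le x : - 2^-1 <= x -> `|ln (1 + x)| <= 2 * `|x|.
Proof.
move=> x2; have x0 : 0 < 1 + x by lra.
have h1 := ln_le_subr1 x0; have h2 := ln_ge_onemV x0.
have e : 1 - (1 + x)^-1 = x / (1 + x) by field; rewrite gt_eqF.
rewrite e in h2.
have h3 : - (2 * `|x|) <= x / (1 + x).
  rewrite ler_pdivlMr//; have := ler_norm (- x); rewrite normrN; have := normr_ge0 x; nra.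
have := ler_norm x; have := normr_ge0 x.
by rewrite ler_norml => ? ?; apply/andP; split; lra.
Qed.

Lemma mulr_ln_div_ge (a b : R) : 0 <= a -> 0 <= b -> (0 < a -> 0 < b) ->
  a - b <= a * ln (a / b).
Proof.
rewrite le_eqVlt => /predU1P[<-|a0] b0 ab; first by rewrite mul0r sub0r oppr_le0.
have {}b0 := ab a0.
have h := ln_ge_onemV (divr_gt0 a0 b0).
have := ler_wpM2l (ltW a0) h.
by rewrite invf_div mulrBr mulr1 mulrCA divff ?gt_eqF// mulr1.
Qed.

End LogInequalities.

Section Divergence.
Context {R : realType} {X Y : finType}.
Implicit Types (P Q : Y -> R).

Lemma divDE P Q : divD P Q = \sum_y P y * llr P Q y.
Proof.
rewrite /divD [RHS](bigID (fun y => P y != 0))/= [X in _ + X]big1 ?addr0// => y.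
by rewrite negbK => /eqP ->; rewrite mul0r.
Qed.

Lemma divVE P Q : divV P Q = \sum_y P y * (llr P Q y - divD P Q) ^+ 2.
Proof.
rewrite /divV [RHS](bigID (fun y => P y != 0))/= [X in _ + X]big1 ?addr0// => y.
by rewrite negbK => /eqP ->; rewrite mul0r.
Qed.

Lemma divD_ge0 P Q : is_dist P -> is_dist Q ->
  (forall y, 0 < P y -> 0 < Q y) -> 0 <= divD P Q.
Proof.
move=> [P0 P1] [Q0 Q1] PQ; rewrite divDE.
apply: (@le_trans _ _ (\sum_y (P y - Q y))); first by rewrite sumrB P1 Q1 subrr.
by apply: ler_sum => y _; apply: mulr_ln_div_ge => //; exact: PQ.
Qed.

(* The compensation identity of Topsoe. *)
Lemma sum_divD_outdist (W : X -> Y -> R) (P : X -> R) Q : channel W -> is_dist P ->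
  (forall y, 0 < outdist P W y -> 0 < Q y) ->
  \sum_x P x * divD (W x) Q = mutI P W + divD (outdist P W) Q.
Proof.
move=> chW [P0 P1] PQ; set r := outdist P W.
have r0 x y : 0 < P x * W x y -> 0 < r y.
  move=> h; apply: (lt_le_trans h); rewrite /r /outdist (bigD1 x)//= lerDl.
  by apply: sumr_ge0 => i _; rewrite mulr_ge0//; have [+ _] := chW i; apply.
rewrite (divDE r Q).
have -> : \sum_y r y * llr r Q y = \sum_x \sum_y P x * W x y * llr r Q y.
  rewrite exchange_big/=; apply: eq_bigr => y _.
  by rewrite {1}/r /outdist mulr_suml.
rewrite /mutI -big_split/=; apply: eq_bigr => x _.
rewrite !divDE !mulr_sumr -big_split/=; apply: eq_bigr => y _.
have W0 : 0 <= W x y by have [+ _] := chW x; apply.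
have : 0 <= P x * W x y by rewrite mulr_ge0.
rewrite le_eqVlt => /predU1P[h|h].
  by rewrite !mulrA -h !mul0r addr0.
have rp := r0 _ _ h; have Qp := PQ _ rp.
have Wp : 0 < W x y.
  by rewrite lt0r W0 andbT; apply: contraTneq h => ->; rewrite mulr0 ltxx.
rewrite !mulrA -mulrDr /llr -lnM ?posrE ?divr_gt0//.
by congr (_ * ln _); rewrite -/r; field; rewrite !gt_eqF.
Qed.

End Divergence.

(** * The optimal output law, its uniqueness, and the tilted test law *)

Section Capacity.
Context {R : realType} {X Y : finType}.
Variable W : X -> Y -> R.
Hypothesis chW : channel W.
Implicit Types (P : X -> R).

Let W0 x y : 0 <= W x y.
Proof. by have [+ _] := chW x; apply. Qed.

Let W1 x y : W x y <= 1.
Proof. by have /andP[] := dist_le1 y (chW x). Qed.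

Lemma outdist_dist P : is_dist P -> is_dist (outdist P W).
Proof.
move=> [P0 P1]; split=> [y|]; first by apply: sumr_ge0 => x _; rewrite mulr_ge0.
rewrite /outdist exchange_big/= -P1; apply: eq_bigr => x _.
by rewrite -mulr_sumr (chW x).2 mulr1.
Qed.

Lemma mutI_le_capacity P : is_dist P -> mutI P W <= capacity W.
Proof.
move=> dP; apply: ub_le_sup; last by exists P.
exists #|Y|%:R => _ [P' dP' <-].
(* Against counting measure divergence is minus entropy, so the identity bounds mutual information
   by output entropy; a supremum needs such a bound. *)
have h := sum_divD_outdist (Q := fun=> 1) chW dP' (fun _ _ => ltr01).
have h1 : \sum_x P' x * divD (W x) (fun=> 1) <= 0.
  apply: sumr_le0 => x _; rewrite mulr_ge0_le0 ?dP'.1// divDE.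
  by apply: sumr_le0 => y _; rewrite mulr_ge0_le0// /llr divr1 ln_le0.
have h2 : - #|Y|%:R <= divD (outdist P' W) (fun=> 1).
  rewrite divDE -sum1_card natr_sum -sumrN; apply: ler_sum => y _.
  have r0 := (outdist_dist dP').1 y.
  by apply: le_trans (mulr_ln_div_ge r0 ler01 (fun _ => ltr01)); lra.
lra.
Qed.

Variables (P0 : X -> R).
Hypotheses (dP0 : is_dist P0) (optP0 : mutI P0 W = capacity W).
Let q := outdist P0 W.

Let dq : is_dist q. Proof. exact: outdist_dist. Qed.
Let q0 y : 0 <= q y. Proof. by have [] := dq. Qed.

(** Move mass [t] of [P0] to the letter [x]: the new information is [(1 - t) (C + D(q || qt)) + t
    D(W x || qt)], at most [C]. The mixture dominates [W x] by construction, so this is usable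
    before [q] is known to do so. *)
Lemma divD_mix_le x (t : R) : 0 < t < 1 ->
  divD (W x) (fun y => (1 - t) * q y + t * W x y) <= capacity W.
Proof.
move=> /andP[t0 t1].
set qt := fun y => _.
pose Pt a := (1 - t) * P0 a + t * (a == x)%:R.
have t10 : 0 < 1 - t by lra.
have dPt : is_dist Pt.
  split=> [a|]; first by rewrite addr_ge0 ?mulr_ge0 ?dP0.1// ltW.
  rewrite big_split/= -!mulr_sumr dP0.2 (bigD1 x)//= eqxx big1 => [|a /negbTE->//];
    rewrite ?addr0 ?mulr1 ?subrK//.
have sumPt (f : X -> R) : \sum_a Pt a * f a = (1 - t) * \sum_a P0 a * f a + t * f x.
  transitivity (\sum_a ((1 - t) * (P0 a * f a) + t * ((a == x)%:R * f a))).
    by apply: eq_bigr => a _; rewrite /Pt; ring.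
  rewrite big_split/= -!mulr_sumr; congr (_ + _ * _).
  by rewrite (bigD1 x)//= eqxx mul1r big1 ?addr0// => a /negbTE->; rewrite mul0r.
have qtE : outdist Pt W = qt by apply/funext => y; rewrite /outdist sumPt.
have dqt : is_dist qt by rewrite -qtE; exact: outdist_dist.
have := mutI_le_capacity dPt; rewrite /mutI sumPt qtE.
have qqt y : 0 < q y -> 0 < qt y.
  by move=> qy; rewrite /qt ltr_pwDl ?mulr_gt0// mulr_ge0// ltW.
rewrite (sum_divD_outdist chW dP0 qqt) optP0.
have := divD_ge0 dq dqt qqt; rewrite -/q => h1 h2.
have h3 : t * divD (W x) qt <= t * capacity W.
  have := mulr_ge0 (ltW t10) h1; lra.
by rewrite ler_pM2l in h3.
Qed.

(** If [q y] vanished, the term at [y] would be [W x y * ln (1 / t)], unbounded as [t] shrinks,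
    while the others sum to at least [- #|Y|]. The chosen [t] makes that term equal to [K]. *)
Lemma channel_ll_opt x y : 0 < W x y -> 0 < q y.
Proof.
move=> Wxy; rewrite lt0r q0 andbT; apply/negP => /eqP qy.
pose K := `|capacity W| + #|Y|%:R + 1.
have K0 : 0 < K by rewrite ltr_wpDl// addr_ge0.
pose t := expR (- (K / W x y)).
have t01 : 0 < t < 1 by rewrite expR_gt0 expR_lt1 oppr_lt0 divr_gt0.
have := divD_mix_le x t01; have /andP[t0 t1] := t01.
rewrite divDE (bigD1 y)//= {1}/llr qy mulr0 add0r.
have -> : W x y / (t * W x y) = t^-1 by field; rewrite !gt_eqF.
rewrite lnV ?posrE// /t expRK opprK mulrCA divff ?gt_eqF// mulr1.
have : - #|Y|%:R <= \sum_(i | i != y) W x i * llr (W x) (fun y => (1 - t) * q y + t * W x y) i.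
  rewrite -sum1_card natr_sum -sumrN (bigD1 y)//= -[leRHS]add0r lerD ?lerN10//.
  apply: ler_sum => i _.
  have h : 0 <= (1 - t) * q i + t * W x i.
    by rewrite addr_ge0 ?mulr_ge0// ?subr_ge0 ltW.
  apply: (@le_trans _ _ (W x i - ((1 - t) * q i + t * W x i))); last first.
    apply: mulr_ln_div_ge => // Wi; rewrite ltr_wpDl ?mulr_gt0// mulr_ge0// subr_ge0 ltW//.
  have := W0 x i; have := W1 x i; have := q0 i; have /andP[_] := dist_le1 i dq.
  nra.
have := ler_norm (capacity W); rewrite /K; lra.
Qed.

(** The limit [t -> 0] of [divD_mix_le], made quantitative: replacing the mixture by [q] costs at
    most [t K], with [K] the second moment of [W x / q] under [q]. *)
Lemma divD_opt_le x : divD (W x) q <= capacity W.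
Proof.
pose K := \sum_y W x y ^+ 2 / q y.
have K0 : 0 <= K by apply: sumr_ge0 => y _; rewrite divr_ge0// sqr_ge0.
have h (t : R) : 0 < t < 1 -> divD (W x) q <= capacity W + t * K.
  move=> t01; have /andP[t0 t1] := t01.
  rewrite -lerBlDr; apply: le_trans (divD_mix_le x t01).
  rewrite !divDE mulr_sumr -sumrB; apply: ler_sum => y _.
  have := W0 x y; rewrite le_eqVlt => /predU1P[<-|Wy].
    by rewrite !mul0r expr0n mul0r mulr0 subr0.
  have qy := channel_ll_opt Wy.
  have qty : 0 < (1 - t) * q y + t * W x y.
    by rewrite ltr_wpDl ?mulr_gt0// mulr_ge0// subr_ge0 ltW.
  rewrite expr2 -mulrA mulrCA -mulrBr ler_wpM2l// /llr !ln_div ?posrE//.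
  have := ln_le_subr1 (divr_gt0 qty qy).
  rewrite ln_div ?posrE//.
  have -> : ((1 - t) * q y + t * W x y) / q y - 1 = t * (W x y / q y) - t.
    by field; rewrite gt_eqF.
  lra.
rewrite leNgt; apply/negP => hlt.
pose e := divD (W x) q - capacity W.
have e0 : 0 < e by rewrite subr_gt0.
pose t := e / (2 * (e + K + 1)).
have D0 : 0 < 2 * (e + K + 1) by lra.
have t0 : 0 < t by rewrite divr_gt0.
have tE : t * (2 * (e + K + 1)) = e by rewrite /t mulfVK ?gt_eqF.
have t1 : t < 1 by rewrite ltr_pdivrMr// mul1r; lra.
have := h t; rewrite t0 t1 => /(_ isT); rewrite -/e => h1.
have h2 : e <= t * K by rewrite /e; lra.
have : 0 < t * (e + 1) by rewrite mulr_gt0// ltr_wpDl// ltW.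
have := mulr_ge0 (ltW t0) K0; lra.
Qed.

Lemma opt_lower_bound : exists m : R, 0 < m <= 1 /\ forall y, 0 < q y -> m <= q y.
Proof.
pose K : R := 1 + \sum_(y | 0 < q y) (q y)^-1.
have K1 : 1 <= K by rewrite lerDl sumr_ge0// => y qy; rewrite invr_ge0.
have K0 : 0 < K by exact: lt_le_trans K1.
exists K^-1; split; first by rewrite invr_gt0 K0 invf_le1.
move=> y qy; rewrite -[leRHS]invrK lef_pV2 ?posrE ?invr_gt0//.
rewrite /K (bigD1 y)//= addrCA lerDl addr_ge0// sumr_ge0// => i /andP[_ _].
by rewrite invr_ge0.
Qed.

Variable m : R.
Hypotheses (m01 : 0 < m <= 1) (mq : forall y, 0 < q y -> m <= q y).

(* Perturbing [q] only slightly towards [PW] keeps log-likelihood ratios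
   bounded, while the divergence still drops quadratically in [PW - q]. *)
Definition tilt P (y : Y) : R := q y + m / 4 * (outdist P W y - q y).

Definition sqdev P : R := \sum_y (outdist P W y - q y) ^+ 2.

Lemma sqdev_ge0 P : 0 <= sqdev P.
Proof. by apply: sumr_ge0 => y _; exact: sqr_ge0. Qed.

Lemma outdist_ll_opt P y : is_dist P -> 0 < outdist P W y -> 0 < q y.
Proof.
move=> dP ry; rewrite lt0r q0 andbT; apply: contraTneq ry => qy.
rewrite -leNgt /outdist big1// => x _.
have := W0 x y; rewrite le_eqVlt => /predU1P[<-|/channel_ll_opt]; first by rewrite mulr0.
by rewrite qy ltxx.
Qed.

Lemma tilt_dist P : is_dist P -> is_dist (tilt P).
Proof.
move=> dP; have [r0 r1] := outdist_dist dP; have /andP[m0 m1] := m01.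
split=> [y|].
  have -> : tilt P y = (1 - m / 4) * q y + m / 4 * outdist P W y by rewrite /tilt; ring.
  by rewrite addr_ge0 ?mulr_ge0//; lra.
by rewrite big_split/= -mulr_sumr sumrB r1 dq.2; ring.
Qed.

Lemma tilt_gt0 P y : is_dist P -> 0 < q y -> 0 < tilt P y.
Proof.
move=> dP qy; have [r0 r1] := outdist_dist dP; have /andP[m0 m1] := m01.
have -> : tilt P y = (1 - m / 4) * q y + m / 4 * outdist P W y by rewrite /tilt; ring.
by rewrite ltr_pwDl ?mulr_gt0 ?mulr_ge0//; lra.
Qed.

(** [x] is the relative change of [q] at [y]. Dividing by [q y] costs at most [1 / m], which the
    factor [m] in [tilt] cancels. *)
Lemma tilt_ratio P y : is_dist P -> 0 < q y ->
  exists x : R, [/\ tilt P y / q y = 1 + x, x * q y = m / 4 * (outdist P W y - q y),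
    `|x| <= 4^-1 & `|x| <= `|outdist P W y - q y| / 4].
Proof.
move=> dP qy; have /andP[m0 m1] := m01.
exists (m / 4 * (outdist P W y - q y) / q y).
have h : `|m / 4 * (outdist P W y - q y) / q y| <= `|outdist P W y - q y| / 4.
  rewrite !normrM !normfV (ger0_norm (ltW m0)) (ger0_norm (q0 y)) (@ger0_norm _ 4)//.
  rewrite ler_pdivrMr//.
  have := ler_wpM2l (normr_ge0 (outdist P W y - q y)) (mq qy); lra.
split => //.
- by rewrite /tilt; field; rewrite gt_eqF.
- by rewrite mulfVK ?gt_eqF.
apply: (le_trans h); rewrite ler_pdivrMr// mulVf//.
have /andP[r0 r1] := dist_le1 y (outdist_dist dP).
have /andP[? ?] := dist_le1 y dq.
by rewrite ler_norml; apply/andP; split; lra.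
Qed.

(** The mutual information cancels between the compensation identities for [q] and for the tilt.
    What remains is the mean of [ln (1 + x)] under [PW], whose first-order part under [q]
    vanishes. *)
Lemma sum_divD_tilt_le P : is_dist P ->
  \sum_x P x * divD (W x) (tilt P) <= capacity W - m / 8 * sqdev P.
Proof.
move=> dP; have [r0 r1] := outdist_dist dP; have /andP[m0 m1] := m01.
set r := outdist P W in r0 r1 *.
have rq y : 0 < r y -> 0 < q y by exact: outdist_ll_opt.
have rt y : 0 < r y -> 0 < tilt P y by move=> /rq; exact: tilt_gt0.
have h1 : \sum_x P x * divD (W x) q <= capacity W.
  rewrite -[leRHS]mul1r -dP.2 mulr_suml; apply: ler_sum => x _.
  by rewrite ler_wpM2l ?dP.1// divD_opt_le.
rewrite (sum_divD_outdist chW dP rt).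
rewrite (sum_divD_outdist chW dP rq) in h1.
suff : m / 8 * sqdev P <= divD r q - divD r (tilt P) by rewrite -/r; rewrite -/r in h1; lra.
(* The added linear term sums to zero; with it the inequality holds letter by letter. *)
apply: (@le_trans _ _ (\sum_y (m / 4 * (r y - q y) + m / 8 * (r y - q y) ^+ 2))).
  by rewrite big_split/= -!mulr_sumr sumrB r1 dq.2 subrr mulr0 add0r.
rewrite !divDE -sumrB; apply: ler_sum => y _.
have := q0 y; rewrite le_eqVlt => /predU1P[qy|qy].
  have -> : r y = 0.
    by apply/eqP; rewrite eq_le r0 andbT leNgt; apply/negP => /rq; rewrite -qy ltxx.
  by rewrite -qy subrr expr0n !mulr0 addr0 !mul0r subr0.
have [x [xE xq x4 _]] := tilt_ratio dP qy; rewrite -/r in xq.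
have ty := tilt_gt0 dP qy.
have {}ry := r0 y.
have -> : r y * llr r q y - r y * llr r (tilt P) y = r y * ln (1 + x).
  move: ry; rewrite le_eqVlt => /predU1P[<-|ry]; first by rewrite !mul0r subrr.
  by rewrite -mulrBr -xE /llr !ln_div ?posrE//; congr (_ * _); ring.
have x2 : - 2^-1 <= x by move: x4; rewrite ler_norml; lra.
apply: le_trans (ler_wpM2l ry (ln1D_ge x2)).
have r1' : r y <= 1 by have /andP[] := dist_le1 y (outdist_dist dP).
have q1' : q y <= 1 by have /andP[] := dist_le1 y dq.
have mqy := mq qy.
set d := r y - q y in xq *.
have rE : r y = q y + d by rewrite /d; ring.
rewrite -subr_ge0 -(pmulr_rge0 _ (mulr_gt0 qy qy)).
(* Multiplied by [q^2], both sides are polynomials in [q], [d] and [m]. *)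
have -> : q y * q y * (r y * (x - 2 * x ^+ 2) - (m / 4 * d + m / 8 * d ^+ 2)) =
   r y * (q y * (x * q y) - 2 * (x * q y) ^+ 2) - q y ^+ 2 * (m / 4 * d + m / 8 * d ^+ 2).
  by ring.
rewrite xq.
have -> : r y * (q y * (m / 4 * d) - 2 * (m / 4 * d) ^+ 2) - q y ^+ 2 * (m / 4 * d + m / 8 * d ^+ 2) =
  m / 8 * d ^+ 2 * (q y * (2 - q y) - m * r y).
  by rewrite rE; field.
apply: mulr_ge0; first by apply: mulr_ge0; [rewrite divr_ge0// ltW|exact: sqr_ge0].
have := ler_wpM2l (ltW m0) r1'; have := ler_wpM2l (ltW qy) q1'; lra.
Qed.

(** For an optimal [P] the compensation identity makes the left side of [sum_divD_tilt_le] at least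
    [C], so the quadratic deficit is zero. *)
Lemma opt_outdist_unique P : is_dist P -> mutI P W = capacity W -> outdist P W = q.
Proof.
move=> dP optP; have /andP[m0 m1] := m01.
have rt y : 0 < outdist P W y -> 0 < tilt P y.
  by move=> /(outdist_ll_opt dP); exact: tilt_gt0.
have h := sum_divD_tilt_le dP.
rewrite (sum_divD_outdist chW dP rt) optP in h.
have h2 := divD_ge0 (outdist_dist dP) (tilt_dist dP) rt.
have h3 : m / 8 * sqdev P <= 0 by lra.
have s0 : sqdev P <= 0.
  by rewrite -(pmulr_rle0 _ (_ : 0 < m / 8))// divr_gt0.
have s00 : sqdev P = 0 by apply/eqP; rewrite eq_le s0 sqdev_ge0.
apply/funext => y; apply/eqP; rewrite -subr_eq0 -sqrf_eq0.
by move/psumr_eq0P: s00 => ->// i _; exact: sqr_ge0.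
Qed.

(** Uniqueness removes the quantifier over optimal inputs and leaves a linear system, to which
    Hoffman's bound applies. *)
Lemma Pi_solution : Pi W = solution (fun y x => W x y) q.
Proof.
apply/seteqP; split => P.
  move=> [dP [P' [dP' [optP' PP']]]]; split => // y.
  by rewrite -(opt_outdist_unique dP' optP') -PP'.
move=> [dP Pq]; split => //; exists P0; split => //; split => //.
by apply/funext => y; exact: Pq.
Qed.

Lemma dispV_Pi P : Pi W P -> dispV P W = \sum_x P x * divV (W x) q.
Proof.
rewrite Pi_solution => -[_ Pq].
by rewrite /dispV (_ : outdist P W = q)//; apply/funext => y; exact: Pq.
Qed.

Lemma dev_le_sqdev P y : `|outdist P W y - q y| <= Num.sqrt (sqdev P).
Proof.
rewrite -sqrtr_sqr ler_sqrt ?sqdev_ge0// /sqdev (bigD1 y)//= lerDl.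
by apply: sumr_ge0 => i _; exact: sqr_ge0.
Qed.

Lemma residual_le_sqdev P :
  residual (fun y x => W x y) q P <= #|Y|%:R * Num.sqrt (sqdev P).
Proof.
rewrite -sum1_card natr_sum mulr_suml; apply: ler_sum => y _.
by rewrite mul1r dev_le_sqdev.
Qed.

(** The summand 1 leaves room for the change of the ratios under the tilt, at most 1/2. *)
Definition llr_bound : R := 1 + \sum_x \sum_y `|llr (W x) q y|.

Lemma llr_bound_ge1 : 1 <= llr_bound.
Proof. by rewrite lerDl; apply: sumr_ge0 => x _; apply: sumr_ge0. Qed.

Let llr_q x y : `|llr (W x) q y| <= llr_bound - 1.
Proof.
rewrite /llr_bound addrAC subrr add0r (bigD1 x)//= (bigD1 y)//= -addrA lerDl.
by rewrite addr_ge0//; apply: sumr_ge0 => i _//; apply: sumr_ge0.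
Qed.

Lemma llr_tilt_sub P x y : is_dist P ->
  `|llr (W x) (tilt P) y - llr (W x) q y| <= 2^-1 /\
  `|llr (W x) (tilt P) y - llr (W x) q y| <= Num.sqrt (sqdev P).
Proof.
move=> dP; have := W0 x y; rewrite le_eqVlt => /predU1P[Wy|Wy].
  by rewrite /llr -Wy !mul0r subrr normr0; split => //; rewrite sqrtr_ge0.
have qy := channel_ll_opt Wy; have ty := tilt_gt0 dP qy.
have [z [zE zq z4 zd]] := tilt_ratio dP qy.
have -> : llr (W x) (tilt P) y - llr (W x) q y = - ln (1 + z).
  by rewrite -zE /llr !ln_div ?posrE//; ring.
have z2 : - 2^-1 <= z by move: z4; rewrite ler_norml; lra.
rewrite normrN; have := norm_ln1D_le z2; have := dev_le_sqdev P y.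
by have := normr_ge0 (outdist P W y - q y); split; lra.
Qed.

Lemma llr_tilt_le P x y : is_dist P -> `|llr (W x) (tilt P) y| <= llr_bound.
Proof.
move=> dP; have [h _] := llr_tilt_sub x y dP; have := llr_q x y.
have := ler_normD (llr (W x) (tilt P) y - llr (W x) q y) (llr (W x) q y).
rewrite subrK; lra.
Qed.

Let norm_mean_le (p : Y -> R) (f : Y -> R) (c : R) : is_dist p ->
  (forall y, `|f y| <= c) -> `|\sum_y p y * f y| <= c.
Proof.
move=> [p0 p1] fc; apply: le_trans (ler_norm_sum _ _ _) _.
rewrite -[leRHS]mul1r -p1 mulr_suml; apply: ler_sum => y _.
by rewrite normrM ger0_norm// ler_wpM2l.
Qed.

Lemma divD_tilt_le P x : is_dist P -> `|divD (W x) (tilt P)| <= llr_bound.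
Proof.
by move=> dP; rewrite divDE; apply: norm_mean_le => // y; exact: llr_tilt_le.
Qed.

Lemma sum_divV_tilt_sub P : is_dist P ->
  `|\sum_x P x * divV (W x) (tilt P) - \sum_x P x * divV (W x) q| <=
  8 * llr_bound * Num.sqrt (sqdev P).
Proof.
move=> dP; set u := Num.sqrt _; have u0 : 0 <= u by exact: sqrtr_ge0.
rewrite -sumrB; under eq_bigr do rewrite -mulrBr.
apply: le_trans (ler_norm_sum _ _ _) _.
apply: (@le_trans _ _ (\sum_x P x * (8 * llr_bound * u))); last first.
  by rewrite -mulr_suml dP.2 mul1r.
apply: ler_sum => x _; rewrite normrM (ger0_norm (dP.1 x)) ler_wpM2l ?dP.1//.
rewrite !divVE -sumrB; under eq_bigr do rewrite -mulrBr.
apply: norm_mean_le => // y.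
set f := llr _ _ y; set g := llr _ _ y; set Df := divD _ _; set Dg := divD _ _.
have fg : `|f - g| <= u by have [_] := llr_tilt_sub x y dP.
have fb : `|f| <= llr_bound by exact: llr_tilt_le.
have gb : `|g| <= llr_bound by have := llr_q x y; rewrite -/g; lra.
have Dfb : `|Df| <= llr_bound by exact: divD_tilt_le.
have Dgb : `|Dg| <= llr_bound.
  by rewrite /Dg divDE; apply: norm_mean_le => // i; have := llr_q x i; lra.
have Dfg : `|Df - Dg| <= u.
  rewrite /Df /Dg !divDE -sumrB; under eq_bigr do rewrite -mulrBr.
  by apply: norm_mean_le => // i; have [_] := llr_tilt_sub x i dP.
have -> : (f - Df) ^+ 2 - (g - Dg) ^+ 2 = ((f - g) - (Df - Dg)) * ((f - Df) + (g - Dg)) by ring.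
rewrite normrM.
have h1 : `|f - g - (Df - Dg)| <= 2 * u by apply: le_trans (ler_normB _ _) _; lra.
have h2 : `|f - Df + (g - Dg)| <= 4 * llr_bound.
  apply: le_trans (ler_normD _ _) _.
  by have := ler_normB f Df; have := ler_normB g Dg; lra.
apply: le_trans (ler_pM (normr_ge0 _) (normr_ge0 _) h1 h2) _.
by rewrite (_ : 2 * u * _ = 8 * llr_bound * u)//; ring.
Qed.

Lemma divV_tilt_le P x : is_dist P -> 0 <= divV (W x) (tilt P) <= 4 * llr_bound ^+ 2.
Proof.
move=> dP; rewrite divVE; apply/andP; split.
  by apply: sumr_ge0 => y _; rewrite mulr_ge0// sqr_ge0.
apply: le_trans (ler_norm _) _; apply: norm_mean_le => // y.
rewrite normrX; have h1 := llr_tilt_le x y dP; have h2 := divD_tilt_le x dP.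
have h3 := ler_normB (llr (W x) (tilt P) y) (divD (W x) (tilt P)).
have h4 : `|llr (W x) (tilt P) y - divD (W x) (tilt P)| <= 2 * llr_bound by lra.
rewrite (_ : 4 * llr_bound ^+ 2 = (2 * llr_bound) ^+ 2); last by ring.
by rewrite lerXn2r// nnegrE; have := llr_bound_ge1; lra.
Qed.

End Capacity.

(** * The converse *)

Section Types.
Context {R : realType} {X : finType} {n : nat}.
Implicit Types x : {ffun 'I_n -> X}.

(** An integer encoding of the type, giving a finite label set of size [(n + 1)^|X|]; [inord] never
    truncates, as a count is at most [n]. *)
Definition counts x : {ffun X -> 'I_n.+1} := [ffun a => inord #|[set i | x i == a]%SET|].

Definition freq (t : {ffun X -> 'I_n.+1}) (a : X) : R := (t a)%:R / n%:R.

Lemma freq_counts x : freq (counts x) = ptype x.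
Proof.
apply/funext => a; rewrite /freq /ptype ffunE inordK; last first.
  by rewrite ltnS -[leqRHS]card_ord max_card.
congr (_%:R / _); apply: eq_card => i.
apply/idP/idP => [|/set_mem h]; last by rewrite finset.inE.
by rewrite finset.inE => h; exact: mem_set.
Qed.

Lemma sum_ptype x (h : X -> R) : (0 < n)%N ->
  \sum_(i < n) h (x i) = n%:R * \sum_a ptype x a * h a.
Proof.
move=> n0; rewrite mulr_sumr (partition_big x predT)//=; apply: eq_bigr => a _.
transitivity (\sum_(i | x i == a) h a); first by apply: eq_bigr => i /eqP->.
have n0' : n%:R != 0 :> R by rewrite pnatr_eq0 -lt0n.
have E (c : nat) : n%:R * (c%:R / n%:R * h a) = c%:R * h a by field.
rewrite sumr_const /ptype E -[LHS]mulr_natl.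
congr (_%:R * _).
by apply: eq_card => i; apply/idP/idP => [ia|/set_mem//]; exact: mem_set.
Qed.

Lemma ptype_dist x : (0 < n)%N -> is_dist (ptype x : X -> R).
Proof.
move=> n0; split=> [a|]; first by rewrite divr_ge0.
have n0' : n%:R != 0 :> R by rewrite pnatr_eq0 -lt0n.
have := sum_ptype x (fun=> 1) n0.
rewrite sumr_const card_ord => /esym h.
apply: (mulfI n0'); rewrite mulr1 -[RHS]h; congr (_ * _).
by apply: eq_bigr => a _; rewrite mulr1.
Qed.

End Types.

Section Converse.
Context {R : realType} {X Y : finType} {n M : nat}.
Variables (W : X -> Y -> R) (f : 'I_M -> {ffun 'I_n -> X}) (g : {ffun 'I_n -> Y} -> 'I_M).
Hypothesis chW : channel W.
Variables (T : finType) (tau : 'I_M -> T) (Q : T -> Y -> R).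
Hypothesis Qdist : forall m, is_dist (Q (tau m)).
Hypothesis Qpos : forall m i y, 0 < W (f m i) y -> 0 < Q (tau m) y.

Definition llrsum (x : {ffun 'I_n -> X}) (q : Y -> R) (y : {ffun 'I_n -> Y}) : R :=
  \sum_i llr (W (x i)) q (y i).

Let Wd m : forall i, is_dist (W (f m i)). Proof. by move=> i; exact: chW. Qed.

Let change_measure m y (gam : R) : 0 < gam -> llrsum (f m) (Q (tau m)) y <= ln gam ->
  Wn W (f m) y <= gam * \prod_i Q (tau m) (y i).
Proof.
move=> g0 Z.
have q0 : 0 <= \prod_i Q (tau m) (y i) by apply: prodr_ge0 => i _; exact: (Qdist m).1.
have [/existsP[i /eqP Wi]|/existsPn Wi] := boolP [exists i, W (f m i) (y i) == 0].
  by rewrite /Wn (bigD1 i)//= Wi mul0r mulr_ge0// ltW.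
have Wp i : 0 < W (f m i) (y i) by rewrite lt0r Wi (chW (f m i)).1.
have Qp i : 0 < Q (tau m) (y i) by exact: Qpos (Wp i).
have -> : Wn W (f m) y = expR (llrsum (f m) (Q (tau m)) y) * \prod_i Q (tau m) (y i).
  rewrite /llrsum expR_sum -big_split/=; apply: eq_bigr => i _.
  by rewrite /llr lnK ?posrE ?divr_gt0// divfK// gt_eqF.
by rewrite ler_wpM2r// -[leRHS]lnK ?posrE// ler_expR.
Qed.

(* Messages sharing a label are tested against the same product law, under
   which their decoding regions, being disjoint, have total mass at most one. *)
Lemma sum_code_prob_le (eps gam : R) : (0 < M)%N -> 0 < gam -> avg_err W f g <= eps ->
  \sum_m pexp (fun i => W (f m i)) (fun y => (llrsum (f m) (Q (tau m)) y <= ln gam)%R%:R)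
  <= M%:R * eps + gam * #|T|%:R.
Proof.
move=> M0 g0 err.
have M0' : 0 < M%:R :> R by rewrite ltr0n.
have e1 : \sum_(m < M) (1 - \sum_(y | g y == m) Wn W (f m) y) <= M%:R * eps.
  by rewrite -ler_pdivrMl.
have e2 : \sum_(m < M) \sum_(y | g y == m) \prod_i Q (tau m) (y i) <= #|T|%:R.
  rewrite (partition_big tau predT)//= -sum1_card natr_sum; apply: ler_sum => t _.
  (* Only labels in use carry a distribution; the others have no messages. *)
  have [/existsP[m0 /eqP m0t]|/existsPn no] := boolP [exists m, tau m == t]; last first.
    by rewrite big_pred0 ?ler01// => m; exact/negbTE/no.
  have dQ : forall i : 'I_n, is_dist (Q t) by move=> _; rewrite -m0t.
  apply: (@le_trans _ _ (\sum_(m < M) \sum_(y | g y == m) \prod_(i < n) Q t (y i))).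
    rewrite [leRHS](bigID (fun m => tau m == t))/= -[leLHS]addr0 lerD//.
      by apply: ler_sum => m /eqP ->.
    by apply: sumr_ge0 => m _; apply: sumr_ge0 => y _; apply: prodr_ge0 => i _; exact: (dQ i).1.
  have <- : \sum_(y : {ffun 'I_n -> Y}) \prod_(i < n) Q t (y i) =
            \sum_(m < M) \sum_(y | g y == m) \prod_(i < n) Q t (y i).
    by rewrite (partition_big g predT).
  rewrite -[leRHS](pexp_cst dQ).
  by apply: ler_sum => y _; rewrite mulr1.
apply: le_trans (lerD e1 (ler_wpM2l (ltW g0) e2)).
rewrite mulr_sumr -big_split/=; apply: ler_sum => m _.
have -> : 1 - \sum_(y | g y == m) Wn W (f m) y = \sum_(y | g y != m) Wn W (f m) y.
  apply/eqP; rewrite subr_eq addrC -(pexp_cst (Wd m) 1); apply/eqP.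
  rewrite /pexp (bigID (fun y => g y == m))/=.
  by congr (_ + _); apply: eq_bigr => y _; rewrite mulr1.
(* Outputs decoded wrongly are charged to the error probability, those decoded correctly to the
   change of measure. *)
rewrite /pexp (bigID (fun y => g y == m))/= addrC lerD//.
  apply: ler_sum => y _; rewrite -[leRHS]mulr1 ler_wpM2l ?(prod_dist_ge0 (Wd m))//.
  by case: (_ <= ln gam).
rewrite mulr_sumr; apply: ler_sum => y _.
case: (leP (llrsum (f m) (Q (tau m)) y) (ln gam)) => [Z|_].
  by rewrite mulr1; exact: change_measure.
rewrite mulr0 mulr_ge0 ?(ltW g0)//.
by apply: prodr_ge0 => i _; exact: (Qdist m).1.
Qed.

End Converse.

(** * The log-likelihood ratio of a single codeword *)

Section Codeword.
Context {R : realType} {X Y : finType} {n : nat}.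
Variables (W : X -> Y -> R) (x : {ffun 'I_n -> X}) (q : Y -> R) (L : R).
Hypothesis chW : channel W.
Hypothesis n0 : (0 < n)%N.
Hypothesis qL : forall a y, `|llr (W a) q y| <= L.

Let D := \sum_a ptype x a * divD (W a) q.
Let V := \sum_a ptype x a * divV (W a) q.
Let p i := W (x i).
Let cen i y : R := llr (W (x i)) q y - divD (W (x i)) q.

Let pd i : is_dist (p i). Proof. exact: chW. Qed.

Let cen0 i : \sum_y p i y * cen i y = 0.
Proof.
under eq_bigr do rewrite mulrBr.
by rewrite sumrB -mulr_suml (pd i).2 mul1r -divDE subrr.
Qed.

Let cen_var : \sum_i \sum_y p i y * cen i y ^+ 2 = n%:R * V.
Proof.
rewrite -(sum_ptype x (fun a => divV (W a) q) n0).
by apply: eq_bigr => i _; rewrite divVE.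
Qed.

Let cenE y : psum cen y = llrsum W x q y - n%:R * D.
Proof. by rewrite /psum sumrB -(sum_ptype x (fun a => divD (W a) q) n0). Qed.

Let cenL i y : `|cen i y| <= 2 * L.
Proof.
have h : `|divD (W (x i)) q| <= L.
  rewrite divDE; apply: le_trans (ler_norm_sum _ _ _) _.
  apply: (@le_trans _ _ (\sum_y W (x i) y * L)); last first.
    by rewrite -mulr_suml (chW (x i)).2 mul1r.
  apply: ler_sum => z _; have W0 := (chW (x i)).1 z.
  by rewrite normrM ger0_norm// ler_wpM2l.
by apply: le_trans (ler_normB _ _) _; have := qL (x i) y; lra.
Qed.

Lemma codeword_chebyshev (k : R) : 0 < k ->
  1 - n%:R * V / k ^+ 2 <= pexp p (fun y => (llrsum W x q y <= n%:R * D + k)%R%:R).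
Proof.
move=> k0; rewrite -cen_var -pexp_psum_sqr// mulrC -pexpZ -{1}(pexp_cst pd 1) -pexpB.
apply: le_pexp => // y; rewrite cenE.
case: (leP (llrsum W x q y) (n%:R * D + k)) => h; rewrite ?mulr1n ?mulr0n.
  by rewrite gerBl mulr_ge0 ?sqr_ge0// invr_ge0 sqr_ge0.
rewrite subr_le0 ler_pdivlMl ?exprn_gt0// mulr1.
by rewrite lerXn2r ?nnegrE//; lra.
Qed.

Lemma codeword_berry_esseen (z : R) : 0 < V -> 0 < L ->
  2 * L <= Num.sqrt (n%:R * V) ->
  Qtail ((n%:R * D - z) / Num.sqrt (n%:R * V)) -
    2 * (mills (0 : R) + 22) * (2 * L / Num.sqrt (n%:R * V)) <=
  pexp p (fun y => (llrsum W x q y <= z)%R%:R).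
Proof.
move=> V0 L0; set s := Num.sqrt _ => Ls.
have s0 : 0 < s by rewrite sqrtr_gt0 mulr_gt0// ltr0n.
have s2 : s ^+ 2 = n%:R * V by rewrite sqr_sqrtr// mulr_ge0// ltW.
pose a i y := cen i y / s.
have a0 i : \sum_y p i y * a i y = 0.
  by under eq_bigr do rewrite mulrA; rewrite -mulr_suml cen0 mul0r.
have a1 : \sum_i \sum_y p i y * a i y ^+ 2 = 1.
  transitivity ((\sum_i \sum_y p i y * cen i y ^+ 2) / s ^+ 2).
    rewrite mulr_suml; apply: eq_bigr => i _; rewrite mulr_suml; apply: eq_bigr => y _.
    by rewrite /a exprMn exprVn mulrA.
  by rewrite cen_var s2 divff// gt_eqF// mulr_gt0// ltr0n.
have ab i y : `|a i y| <= 2 * L / s.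
  by rewrite normrM normfV (ger0_norm (ltW s0)) ler_pM2r ?invr_gt0.
have b01 : 0 < 2 * L / s <= 1.
  by rewrite divr_gt0 ?mulr_gt0//= ler_pdivrMr// mul1r.
have := berry_esseen pd a0 a1 ab b01 ((z - n%:R * D) / s).
rewrite ler_norml => /andP[h _].
have -> : Qtail ((n%:R * D - z) / s) = 1 - Qtail ((z - n%:R * D) / s).
  by rewrite -QtailN; congr Qtail; rewrite -mulNr opprB.
have -> : pexp p (fun y => (llrsum W x q y <= z)%R%:R) =
          pexp p (fun y => (psum a y <= (z - n%:R * D) / s)%R%:R) :> R; last by lra.
apply: eq_pexp => y; congr (_%:R); congr nat_of_bool.
have -> : psum a y = psum cen y / s by rewrite /psum mulr_suml.
by rewrite ler_pM2r ?invr_gt0// cenE lerD2r.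
Qed.

End Codeword.

(** * Distance of a type to the optimal inputs *)

Section Geometry.
Context {R : realType} {X : finType}.

Lemma supdist_le (P P' : X -> R) (c : R) : 0 <= c ->
  (forall x, `|P x - P' x| <= c) -> supdist P P' <= c.
Proof. by move=> c0 h; apply: bigmax_le. Qed.

Lemma lin_dist_le (v : X -> R) (P P' : X -> R) (c : R) :
  (forall x, `|P x - P' x| <= c) ->
  `|\sum_x P x * v x - \sum_x P' x * v x| <= c * \sum_x `|v x|.
Proof.
move=> h; rewrite -sumrB mulr_sumr.
apply: le_trans (ler_norm_sum _ _ _) _; apply: ler_sum => x _.
by rewrite -mulrBl normrM ler_wpM2r.
Qed.

Lemma solution_max {J : finType} (A : J -> X -> R) (b : J -> R) (v : X -> R) :
  (exists s, solution A b s) -> exists2 s, solution A b s &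
    forall s', solution A b s' -> \sum_x s' x * v x <= \sum_x s x * v x.
Proof.
move=> S0; have [s sS h] := solution_min (fun x => - v x) S0.
exists s => // s' s'S.
have E (z : X -> R) : \sum_x z x * - v x = - \sum_x z x * v x.
  by rewrite -sumrN; apply: eq_bigr => x _; rewrite mulrN.
rewrite -lerN2 -!E.
rewrite h; apply: ge_inf; last by exists s'.
exists (- \sum_x `|- v x|) => _ [z zS <-].
rewrite -sumrN; apply: ler_sum => x _.
have /andP[h0 h1] := dist_le1 x zS.1.
have := ler_norm (- - v x); rewrite normrN => hn.
have : z x * `|- v x| <= `|- v x| by rewrite ler_piMl.
have := ler_wpM2l h0 hn; lra.
Qed.

End Geometry.

Section Assembly.
Context {R : realType} {X Y : finType}.
Variables (W : X -> Y -> R) (eps : R).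
Hypotheses (chW : channel W) (a1 : A1 W) (eps01 : 0 < eps < 1).

(** [capacity] is a supremum, so attainment needs a reason: were [Pi W] empty, [Vmin W] would be the
    infimum of the empty set, which is 0 and contradicts [A1]. *)
Lemma A1_opt : exists P0, is_dist P0 /\ mutI P0 W = capacity W.
Proof.
have [[P [_ [P0 [dP0 [oP0 _]]]]]|] := pselect (exists P, Pi W P); first by exists P0.
move=> no; suff : Vmin W = 0 by move=> V0; move: a1; rewrite /A1 V0 ltxx.
rewrite /Vmin (_ : [set dispV P W | P in Pi W] = set0) ?inf0//.
by apply/seteqP; split => // z [P PP _]; apply: no; exists P.
Qed.

Variables (P0 : X -> R).
Hypotheses (dP0 : is_dist P0) (optP0 : mutI P0 W = capacity W).
Variable m : R.
Hypotheses (m01 : 0 < m <= 1) (mq : forall y, 0 < outdist P0 W y -> m <= outdist P0 W y).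

Let q := outdist P0 W.
Let S := solution (fun y x => W x y) q.
Let v x := divV (W x) q.
Let lin (P : X -> R) := \sum_x P x * v x.
Let u P := Num.sqrt (sqdev W P0 P).

Let PiS : Pi W = S. Proof. exact: (Pi_solution chW dP0 optP0 m01 mq). Qed.

Let dispVE P : S P -> dispV P W = lin P.
Proof. by rewrite -PiS; exact: (dispV_Pi chW dP0 optP0 m01 mq). Qed.

Let SP0 : S P0. Proof. by split. Qed.

Let u0 P : 0 <= u P. Proof. exact: sqrtr_ge0. Qed.

Let v0 x : 0 <= v x.
Proof. by rewrite /v divVE; apply: sumr_ge0 => y _; rewrite mulr_ge0 ?sqr_ge0// (chW x).1. Qed.

Let lin0 s : S s -> 0 <= lin s.
Proof. by move=> [[s0 _] _]; apply: sumr_ge0 => x _; rewrite mulr_ge0. Qed.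

Let Vmin_le s : S s -> Vmin W <= lin s.
Proof.
move=> sS; rewrite -dispVE//; apply: ge_inf; last by exists s => //; rewrite PiS.
by exists 0 => _ [P + <-]; rewrite PiS => PS; rewrite dispVE// lin0.
Qed.

Let Vmax_ge s : S s -> lin s <= Vmax W.
Proof.
move=> sS; rewrite -dispVE//; apply: ub_le_sup; last by exists s => //; rewrite PiS.
have [z zS zmax] := solution_max v (ex_intro _ _ sS).
by exists (lin z) => _ [P + <-]; rewrite PiS => PS; rewrite dispVE// zmax.
Qed.

Let Vmin_att : exists2 s, S s & lin s = Vmin W.
Proof.
have [s sS h] := solution_min v (ex_intro _ _ SP0).
exists s => //; apply/eqP; rewrite eq_le Vmin_le// andbT.
apply: lb_le_inf; first by exists (dispV P0 W), P0 => //; rewrite PiS.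
move=> _ [P + <-]; rewrite PiS => PS; rewrite dispVE// /lin h.
apply: ge_inf; last by exists P.
by exists 0 => _ [z zS <-]; exact: lin0.
Qed.

Let Vmax_att : exists2 s, S s & lin s = Vmax W.
Proof.
have [s sS h] := solution_max v (ex_intro _ _ SP0).
exists s => //; apply/eqP; rewrite eq_le Vmax_ge//=.
apply: ge_sup; first by exists (dispV P0 W), P0 => //; rewrite PiS.
by move=> _ [P + <-]; rewrite PiS => PS; rewrite dispVE//; exact: h.
Qed.

Lemma Veps_ge : Vmin W <= Veps W eps.
Proof.
rewrite /Veps; case: ifP => // _; have [s sS <-] := Vmax_att; exact: Vmin_le.
Qed.

Let Veps_att : exists2 s, S s & lin s = Veps W eps.
Proof. by rewrite /Veps; case: ifP. Qed.

Let near_S : exists K : R, 0 < K /\ forall P, is_dist P ->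
  exists2 s, S s & forall x, `|P x - s x| <= K * u P.
Proof.
have [K [K0 h]] := hoffman (ex_intro _ _ SP0).
exists (K * (#|Y|%:R + 1)); split; first by rewrite mulr_gt0// ltr_wpDl.
move=> P dP; have [s sS sP] := h _ dP; exists s => // x.
apply: le_trans (sP x) _; rewrite -mulrA ler_wpM2l ?(ltW K0)//.
apply: le_trans (residual_le_sqdev W P0 P) _.
by rewrite ler_wpM2r// lerDl.
Qed.

(** Dispersion is linear on [Pi], so its prescribed value is one more row, indexed by [None], of the
    system given to [hoffman]. *)
Let near_Pistar : exists K : R, 0 < K /\ forall P, is_dist P ->
  exists2 s, (Pi W s /\ dispV s W = Veps W eps) &
    forall x, `|P x - s x| <= K * (u P + `|lin P - Veps W eps|).
Proof.
pose A' (j : option Y) := if j is Some y then fun x => W x y else v.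
pose b' (j : option Y) := if j is Some y then q y else Veps W eps.
have S'E s : solution A' b' s <-> S s /\ lin s = Veps W eps.
  split=> [[ds h]|[[ds h] h']].
    by split; [split => // y; exact: (h (Some y))|exact: (h None)].
  by split => // -[y|]; [exact: h|exact: h'].
have [|K [K0 h]] := @hoffman R X _ A' b'.
  by have [s sS sV] := Veps_att; exists s; apply/S'E.
exists (K * (#|Y|%:R + 1)); split; first by rewrite mulr_gt0// ltr_wpDl.
move=> P dP; have [s /S'E[sS sV] sP] := h _ dP.
exists s; first by rewrite PiS dispVE.
move=> x; apply: le_trans (sP x) _; rewrite -mulrA ler_wpM2l ?(ltW K0)//.
rewrite /residual big_option_sum/= -/(lin P).
have h1 := residual_le_sqdev W P0 P; rewrite /residual -/q -/(u P) in h1.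
apply: le_trans (lerD (lexx _) h1) _.
have := normr_ge0 (lin P - Veps W eps); have := u0 P.
have : 0 <= #|Y|%:R :> R by [].
nra.
Qed.

Let lin_bounds : exists K : R, 0 < K /\ forall P, is_dist P ->
  Vmin W - K * u P <= lin P <= Vmax W + K * u P.
Proof.
have [K [K0 h]] := near_S.
have v1 : 0 <= \sum_x `|v x| by exact: sumr_ge0.
exists (K * (\sum_x `|v x| + 1)); split; first by rewrite mulr_gt0// ltr_wpDl.
move=> P /h[s sS sP]; have := lin_dist_le v sP; rewrite -!/(lin _).
have := Vmin_le sS; have := Vmax_ge sS; have := mulr_ge0 (ltW K0) (u0 P).
by rewrite ler_norml => ? ? ? /andP[? ?]; apply/andP; split; lra.
Qed.

(** The absolute value in [near_Pistar] becomes a signed term because [Veps] is extremal: for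
    [eps < 1/2] it is [Vmin], which [lin P] undercuts by at most [K2 u], so the absolute value
    exceeds the signed difference by at most [2 K2 u]. For [eps > 1/2] the picture is reflected; at
    [1/2] the sign is 0 and [Pistar] is [Pi]. *)
Lemma outside_Pistar : exists c K : R, [/\ 0 < c, 0 < K &
  forall P, is_dist P -> Vmin W - K * u P <= lin P /\
    forall d : R, 0 <= d -> ~ Pistar_nbhd W eps d P ->
      c * d <= K * u P + Num.sg (teps eps) * (lin P - Veps W eps)].
Proof.
have [K1 [K10 h1]] := near_S; have [K2 [K20 h2]] := lin_bounds.
have [K3 [K30 h3]] := near_Pistar.
have far (P : X -> R) d s (e : R) : 0 <= d -> 0 <= e -> ~ Pistar_nbhd W eps d P -> Pistar W eps s ->
    (forall x, `|P x - s x| <= e) -> d <= e.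
  move=> d0 e0 no sP h; rewrite leNgt; apply/negP => ed; apply: no; exists s; split => //.
  by apply: supdist_le => // x; exact: le_trans (h x) (ltW ed).
have [e12|e12|e12] := ltgtP eps 2^-1.
- exists K3^-1, (1 + 2 * K2); split; rewrite ?invr_gt0//; first by lra.
  move=> P dP; have /andP[hmin hmax] := h2 _ dP; have uP := u0 P.
  split; first by have := mulr_ge0 (ltW K20) uP; lra.
  have t0 : 0 < teps eps by apply: teps_gt0; have /andP[-> _] := eps01.
  move=> d d0 no; rewrite gtr0_sg// mul1r.
  have [s sV sP] := h3 _ dP.
  have VE : Veps W eps = Vmin W by rewrite /Veps ltW.
  have hd : d <= K3 * (u P + `|lin P - Veps W eps|).
    apply: (far _ _ s) no _ sP => //; first by rewrite mulr_ge0 ?addr_ge0// ltW.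
    by rewrite /Pistar lt_eqF.
  rewrite ler_pdivrMl//; apply: le_trans hd _; rewrite ler_pM2l//.
  have : `|lin P - Veps W eps| <= lin P - Veps W eps + 2 * K2 * u P.
    by rewrite VE ler_norml; apply/andP; split; have := mulr_ge0 (ltW K20) uP; lra.
  lra.
- exists K3^-1, (1 + 2 * K2); split; rewrite ?invr_gt0//; first by lra.
  move=> P dP; have /andP[hmin hmax] := h2 _ dP; have uP := u0 P.
  split; first by have := mulr_ge0 (ltW K20) uP; lra.
  have t0 : teps eps < 0 by apply: teps_lt0; rewrite e12; have /andP[_ ->] := eps01.
  move=> d d0 no; rewrite ltr0_sg// mulN1r.
  have [s sV sP] := h3 _ dP.
  have VE : Veps W eps = Vmax W by rewrite /Veps leNgt e12.
  have hd : d <= K3 * (u P + `|lin P - Veps W eps|).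
    apply: (far _ _ s) no _ sP => //; first by rewrite mulr_ge0 ?addr_ge0// ltW.
    by rewrite /Pistar gt_eqF.
  rewrite ler_pdivrMl//; apply: le_trans hd _; rewrite ler_pM2l//.
  have : `|lin P - Veps W eps| <= - (lin P - Veps W eps) + 2 * K2 * u P.
    by rewrite VE ler_norml; apply/andP; split; have := mulr_ge0 (ltW K20) uP; lra.
  lra.
- exists K1^-1, (1 + K2); split; rewrite ?invr_gt0//; first by lra.
  move=> P dP; have /andP[hmin hmax] := h2 _ dP; have uP := u0 P.
  split; first by lra.
  move=> d d0 no; rewrite e12 teps_half sgr0 mul0r addr0.
  have [s sS sP] := h1 _ dP.
  have hd : d <= K1 * u P.
    apply: (far _ _ s) no _ sP => //; first by rewrite mulr_ge0// ltW.
    by rewrite /Pistar e12 eqxx PiS.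
  rewrite ler_pdivrMl//; apply: le_trans hd _; rewrite ler_pM2l//.
  by have := mulr_ge0 (ltW K20) uP; lra.
Qed.

End Assembly.

Lemma quadratic_ge {R : realType} (a b w : R) : 0 < a ->
  - (b ^+ 2 / (4 * a)) <= a * w ^+ 2 - b * w.
Proof.
move=> a0; rewrite -subr_ge0.
have -> : a * w ^+ 2 - b * w - - (b ^+ 2 / (4 * a)) = a * (w - b / (2 * a)) ^+ 2.
  by field; rewrite gt_eqF.
by rewrite mulr_ge0 ?sqr_ge0// ltW.
Qed.

(* [N] stands for the square root of the blocklength, [u] for the deviation of
   the output law, [sp] and [se] for the standard deviations of the codeword and
   of the optimum: the quadratic term pays for every first-order loss in [u]. *)
Lemma dispersion_gain {R : realType} (t g c K d0 d1 : R) :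
  0 < g -> 0 < c -> 0 < K -> 0 < d0 -> 0 < d1 ->
  exists c' K' : R, [/\ 0 < c', 0 <= K' &
  forall N d u sp se : R, 0 <= N -> 0 <= d -> 1 <= N * d -> 0 <= u ->
    d0 <= sp + se <= d1 -> c * d <= K * u + Num.sg t * (sp ^+ 2 - se ^+ 2) ->
    c' * (N * d) - K' <= g * (N * u) ^+ 2 + t * (N * (sp - se))].
Proof.
move=> g0 c0 K0 d00 d10; have [->|tn0] := eqVneq t 0.
  (* With [t = 0] only the quadratic term gains, and [1 <= N * d] lets [(N d)^2] be weakened to
     [N d]. *)
  exists (g * (c / K) ^+ 2), 0; split => //.
    by rewrite mulr_gt0// exprn_gt0// divr_gt0.
  move=> N d u sp se N0 dd Nd u0 _; rewrite sgr0 !mul0r !addr0 subr0 => h.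
  have h1 : c / K * d <= u by rewrite mulrAC ler_pdivrMr// mulrC; lra.
  have h2 : 0 <= c / K by rewrite divr_ge0 ?ltW.
  have h3 : c / K * (N * d) <= N * u by rewrite mulrCA ler_wpM2l.
  rewrite -mulrA ler_pM2l//; apply: (@le_trans _ _ ((c / K * (N * d)) ^+ 2)).
    rewrite [leRHS]exprMn ler_wpM2l ?sqr_ge0// expr2 ler_peMl//; exact: le_trans ler01 Nd.
  by rewrite lerXn2r// nnegrE; apply: mulr_ge0 => //; apply: mulr_ge0.
have t0 : 0 < `|t| by rewrite normr_gt0.
(* [K'] is what completing the square costs: minus the minimum of [g w^2 - (|t| K / d0) w]. *)
exists (`|t| * c / d1), ((`|t| * K / d0) ^+ 2 / (4 * g)); split.
- by rewrite divr_gt0 ?mulr_gt0.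
- by rewrite divr_ge0 ?sqr_ge0// mulr_ge0// ltW.
move=> N d u sp se N0 dd Nd u0 /andP[sd0 sd1] h.
have s0 : 0 < sp + se by exact: lt_le_trans sd0.
set D := Num.sg t * (sp - se).
have tD : t * (N * (sp - se)) = `|t| * (N * D).
  by rewrite {1}[t]numEsg /D; ring.
(* Factoring [sp^2 - se^2] passes from variances to standard deviations; the gain is divided by the
   upper bound of [sp + se], the loss by the lower one. *)
have hD : c * d / d1 - K * u / d0 <= D.
  have h1 : c * d - K * u <= D * (sp + se).
    by rewrite (_ : D * (sp + se) = Num.sg t * (sp ^+ 2 - se ^+ 2)) /D; [lra|ring].
  have h2 : (c * d - K * u) / (sp + se) <= D by rewrite ler_pdivrMr.
  apply: le_trans h2; rewrite mulrBl lerB//.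
    by rewrite ler_wpM2l ?lef_pV2 ?posrE// mulr_ge0// ltW.
  by rewrite ler_wpM2l ?lef_pV2 ?posrE// mulr_ge0// ltW.
rewrite tD.
have h4 : `|t| * (N * (c * d / d1 - K * u / d0)) <= `|t| * (N * D).
  by rewrite ler_pM2l// ler_wpM2l.
have := quadratic_ge (`|t| * K / d0) (N * u) g0.
have -> : `|t| * c / d1 * (N * d) = `|t| * (N * (c * d / d1)) by ring.
have e : `|t| * (N * (c * d / d1 - K * u / d0)) =
  `|t| * (N * (c * d / d1)) - `|t| * K / d0 * (N * u) by ring.
rewrite e in h4; lra.
Qed.

Section CodewordProbability.
Context {R : realType} {X Y : finType}.
Variables (W : X -> Y -> R) (eps : R).
Hypotheses (chW : channel W) (a1 : A1 W) (eps01 : 0 < eps < 1).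
Variables (P0 : X -> R).
Hypotheses (dP0 : is_dist P0) (optP0 : mutI P0 W = capacity W).
Variable m : R.
Hypotheses (m01 : 0 < m <= 1) (mq : forall y, 0 < outdist P0 W y -> m <= outdist P0 W y).

(** The surplus [1 / sqrt n] over [eps] is what survives in the converse once the error probability
    is subtracted. *)
Lemma codeword_prob : exists c K B : R, 0 < c /\
  forall (n : nat) (x : {ffun 'I_n -> X}) (d : R), (0 < n)%N ->
  B <= Num.sqrt n%:R -> 0 <= d <= 1 -> 1 <= Num.sqrt n%:R * d ->
  ~ Pistar_nbhd W eps d (ptype x) ->
  eps + (Num.sqrt n%:R)^-1 <= pexp (fun i => W (x i)) (fun y =>
    (llrsum W x (tilt W P0 m (ptype x)) y <= n%:R * capacity W -
      Num.sqrt (n%:R * Veps W eps) * teps eps - c * (Num.sqrt n%:R * d) + K)%R%:R).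
Proof.
have [c4 [K5 [c40 K50 out]]] := outside_Pistar chW eps01 dP0 optP0 m01 mq.
have Vm0 : 0 < Vmin W := a1.
have Ve := Veps_ge eps chW dP0 optP0 m01 mq.
have Ve0 : 0 < Veps W eps by exact: lt_le_trans Ve.
have /andP[m0 m1] := m01.
have /andP[eps0 eps1] := eps01.
set L := llr_bound W P0; have L1 : 1 <= L by exact: llr_bound_ge1.
set t := teps eps; set C := capacity W; set se := Num.sqrt (Veps W eps).
have se0 : 0 < se by rewrite sqrtr_gt0.
pose K7 := K5 + 8 * L; have K70 : 0 < K7 by rewrite /K7; lra.
have g0 : 0 < m / 8 by rewrite divr_gt0.
have L0 : 0 < L by lra.
have d10 : 0 < 2 * L + se by lra.
have [c' [Kg [c'0 Kg0 gain]]] := dispersion_gain t g0 c40 K70 se0 d10.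
have [cq cq0 hq] := Qtail_ge_lin t.
pose C0 := 2 * (mills (0 : R) + 22).
have C00 : 0 < C0 by rewrite /C0 mulr_gt0// ltr_wpDl// mills_ge0.
(* Raising the threshold by [K13] adds at least [cq K13 / s] to the tail. This pays the Berry-Esseen
   error [C0 (2 L) / s] and leaves [2 L / s], at least [1 / sqrt n]. *)
pose K13 := (C0 * (2 * L) + 2 * L) / cq.
have L2 : 0 < 2 * L by lra.
have K130 : 0 < K13.
  by rewrite /K13; apply: divr_gt0 => //; apply: addr_gt0 => //; exact: mulr_gt0.
(* Since [V >= Vmin - K7 u], a variance below [Vmin / 2] forces [u >= u0], and then a mean deficit
   of [gg] per letter. *)
pose u0 := Vmin W / (2 * K7); have u00 : 0 < u0 by rewrite divr_gt0// mulr_gt0.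
pose gg := m / 8 * u0 ^+ 2; have gg0 : 0 < gg by rewrite mulr_gt0// exprn_gt0.
pose sv := Num.sqrt (Vmin W / 2); have sv0 : 0 < sv by rewrite sqrtr_gt0 divr_gt0.
(* [B1] validates Berry-Esseen and the linear tail bound, [B2] puts the terms of order [sqrt n]
   below half of [n gg], and [B3] fits the Chebyshev error plus [1 / sqrt n] into [1 - eps]. *)
pose B1 := (2 * L + K13) / sv.
pose B2 := 2 * (`|t| * se + c') / gg.
pose B3 := (2 * Vmin W / gg ^+ 2 + 1) / (1 - eps).
have B10 : 0 <= B1 by rewrite /B1 divr_ge0 ?(ltW sv0)//; lra.
have B20 : 0 <= B2.
  rewrite /B2 divr_ge0 ?(ltW gg0)// mulr_ge0// addr_ge0 ?(ltW c'0)//.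
  by rewrite mulr_ge0 ?(ltW se0).
have B30 : 0 <= B3.
  rewrite /B3 divr_ge0//; last by lra.
  rewrite addr_ge0// divr_ge0 ?sqr_ge0//; lra.
exists c', (Kg + K13), (1 + B1 + B2 + B3); split => // n x d n0.
set N := Num.sqrt n%:R => BN /andP[d0 d1] Nd out_x.
have N1 : 1 <= N by clear -BN B10 B20 B30; lra.
have N0 : 0 < N by exact: lt_le_trans N1.
have nN : n%:R = N ^+ 2 :> R by rewrite sqr_sqrtr.
set P := ptype x in out_x *.
have dP : is_dist P by exact: ptype_dist.
set Q := tilt W P0 m P.
set D := \sum_a P a * divD (W a) Q.
set V := \sum_a P a * divV (W a) Q.
set u := Num.sqrt (sqdev W P0 P).
have uu0 : 0 <= u by exact: sqrtr_ge0.
have [lo far] := out _ dP.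
have := far _ d0 out_x; rewrite -/u -/t => {}far.
rewrite -/u in lo.
have VlP : `|V - \sum_a P a * divV (W a) (outdist P0 W)| <= 8 * L * u.
  exact: sum_divV_tilt_sub.
have DC : D <= C - m / 8 * u ^+ 2.
  have := sum_divD_tilt_le chW dP0 optP0 m01 mq dP.
  by rewrite -/Q -/D -/C /u sqr_sqrtr// sqdev_ge0.
have V0 : 0 <= V.
  apply: sumr_ge0 => a _; rewrite mulr_ge0 ?dP.1//.
  by have /andP[] := divV_tilt_le chW dP0 optP0 m01 mq a dP.
have V4 : V <= (2 * L) ^+ 2.
  apply: (@le_trans _ _ (\sum_a P a * (4 * L ^+ 2))).
    apply: ler_sum => a _; rewrite ler_wpM2l ?dP.1//.
    by have /andP[] := divV_tilt_le chW dP0 optP0 m01 mq a dP.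
  by rewrite -mulr_suml dP.2 mul1r exprMn -natrX.
set lP := \sum_a P a * divV (W a) (outdist P0 W) in lo far VlP.
have sVlP : Num.sg t * (lP - V) <= 8 * L * u.
  apply: le_trans (ler_norm _) _; rewrite normrM distrC.
  apply: le_trans VlP; rewrite ler_piMl//.
  by rewrite normr_sg; case: (t != 0).
have {}far : c4 * d <= K7 * u + Num.sg t * (V - Veps W eps) by rewrite /K7; clear -far sVlP; lra.
have {}lo : Vmin W - K7 * u <= V.
  by move: VlP; rewrite ler_norml /K7 => /andP[h1 h2]; clear -lo h1 h2; lra.
have qL a y : `|llr (W a) Q y| <= L by exact: llr_tilt_le.
rewrite sqrtrM ?ler0n// -/N -/se.
set z := _ + (Kg + K13).
have [Vbig|Vsmall] := leP (Vmin W / 2) V.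
- have Vpos : 0 < V by apply: lt_le_trans Vbig; rewrite divr_gt0.
  pose sp := Num.sqrt V.
  have sp0 : 0 < sp by rewrite sqrtr_gt0.
  have spV : sp ^+ 2 = V by rewrite sqr_sqrtr.
  have seV : se ^+ 2 = Veps W eps by rewrite sqr_sqrtr// ltW.
  have sp2L : sp <= 2 * L.
    by rewrite -(ler_pXn2r (ltn0Sn 1)) ?nnegrE ?spV ?(ltW sp0) ?(ltW L2).
  have spsv : sv <= sp by rewrite ler_sqrt.
  have sE : Num.sqrt (n%:R * V) = N * sp by rewrite sqrtrM ?ler0n.
  set s := N * sp in sE.
  have s0 : 0 < s by rewrite mulr_gt0.
  have sbig : 2 * L + K13 <= s.
    apply: (@le_trans _ _ (N * sv)); last by rewrite ler_pM2l.
    by rewrite -ler_pdivrMr// -/B1; clear -BN B10 B20 B30; lra.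
  have G := gain N d u sp se (ltW N0) d0 Nd uu0.
  rewrite spV seV in G.
  have {}G := G _ far.
  have {}G : c' * (N * d) - Kg <= m / 8 * (N * u) ^+ 2 + t * (N * (sp - se)).
    by apply: G; rewrite lerDr ltW//= lerD2r.
  have := codeword_berry_esseen chW n0 qL z Vpos L0.
  rewrite -/P -/D -/V sE -/C0 => BE.
  have {}BE := BE (le_trans (ler_wpDr (ltW K130) (lexx _)) sbig).
  apply: le_trans BE.
  have hz : (n%:R * D - z) / s <= t - K13 / s.
    rewrite ler_pdivrMr// mulrBl divfK ?gt_eqF// /z nN.
    have h1 : N ^+ 2 * D <= N ^+ 2 * (C - m / 8 * u ^+ 2) by rewrite ler_wpM2l ?sqr_ge0.
    have e1 : N ^+ 2 * (C - m / 8 * u ^+ 2) = N ^+ 2 * C - m / 8 * (N * u) ^+ 2 by ring.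
    have e2 : t * (N * (sp - se)) = t * s - N * se * t by rewrite /s; ring.
    by rewrite e1 in h1; rewrite e2 in G; clear -h1 G; lra.
  have h01 : 0 <= K13 / s <= 1.
    rewrite divr_ge0 ?(ltW K130) ?(ltW s0)//= ler_pdivrMr// mul1r.
    by clear -sbig L2; lra.
  have h2 := hq _ h01.
  have h3 := Qtail_le hz.
  rewrite Qtail_teps // in h2.
  have h4 : N^-1 <= cq * (K13 / s) - C0 * (2 * L / s).
    have -> : cq * (K13 / s) - C0 * (2 * L / s) = 2 * L / s.
      by rewrite /K13; field; rewrite !gt_eqF.
    rewrite -[leLHS]mul1r ler_pdivrMr// mulrAC ler_pdivlMr// mul1r /s.
    by rewrite mulrC ler_pM2r.
  by clear -h2 h3 h4; lra.
- have uu : u0 <= u.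
    by rewrite /u0 ler_pdivrMr ?mulr_gt0//; clear -lo Vsmall; lra.
  have uu2 : u0 ^+ 2 <= u ^+ 2 by rewrite lerXn2r// nnegrE ltW.
  have Dgg : D <= C - gg.
    by have := ler_wpM2l (ltW g0) uu2; rewrite -/gg; clear -DC; lra.
  (* Half of the deficit serves as Chebyshev margin, the other half covers the terms of order
     [sqrt n] in the threshold. *)
  pose k := n%:R * gg / 2.
  have k0 : 0 < k by rewrite divr_gt0// mulr_gt0// ltr0n.
  have Cb := codeword_chebyshev x Q chW n0 k0.
  rewrite -/P -/D -/V in Cb.
  apply: le_trans (_ : 1 - n%:R * V / k ^+ 2 <= _).
    have -> : n%:R * V / k ^+ 2 = 4 * V / gg ^+ 2 / N ^+ 2.
      by rewrite /k nN; field; rewrite !gt_eqF.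
    have h1 : 4 * V / gg ^+ 2 / N ^+ 2 <= 2 * Vmin W / gg ^+ 2 / N.
      have -> : 4 * V / gg ^+ 2 / N ^+ 2 = 4 * V / gg ^+ 2 / N / N.
        by field; rewrite !gt_eqF.
      rewrite ler_pM2r ?invr_gt0// ler_pdivrMr//.
      apply: (@le_trans _ _ (2 * Vmin W / gg ^+ 2)).
        by rewrite ler_pM2r ?invr_gt0 ?exprn_gt0//; lra.
      by rewrite ler_peMr// divr_ge0 ?sqr_ge0// mulr_ge0// ltW.
    have h2 : 2 * Vmin W / gg ^+ 2 / N + N^-1 <= 1 - eps.
      rewrite -[X in _ + X]mul1r -mulrDl ler_pdivrMr// [leRHS]mulrC.
      have : B3 <= N by clear -BN B10 B20 B30; lra.
      by rewrite /B3 ler_pdivrMr ?subr_gt0.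
    by clear -h1 h2; lra.
  apply: le_trans Cb _; apply: le_pexp => [i|y]; first exact: chW.
  apply: ler_nat_of_bool => /le_trans; apply.
  have h1 : n%:R * D <= n%:R * (C - gg) by rewrite ler_wpM2l ?ler0n.
  have h2 : N * (`|t| * se + c') <= k.
    have -> : k = N * (N * gg / 2) by rewrite /k nN; ring.
    rewrite ler_pM2l// ler_pdivlMr// mulrC -ler_pdivrMr//.
    by rewrite -/B2; clear -BN B10 B20 B30; lra.
  have h3 : N * se * t <= N * (`|t| * se).
    by rewrite -mulrA ler_pM2l// mulrC ler_pM2r// ler_norm.
  have h4 : c' * (N * d) <= N * c'.
    by rewrite mulrCA ler_pM2l// ler_piMr// ltW.
  have h5 : k + k = n%:R * gg by rewrite /k; field.
  by rewrite /z; clear -h1 h2 h3 h4 h5 Kg0 K130; lra.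
Qed.

End CodewordProbability.

(** * Growth of the gain against logarithmic remainders *)

Section Asymptotics.
Context {R : realType}.
Implicit Types n : nat.

Lemma ln_nat_ge (A : R) : exists N : nat, forall n, (N <= n)%N -> A <= ln (n%:R : R).
Proof.
exists (Num.bound (expR A)) => n Nn.
have h : expR A <= n%:R.
  by apply: le_trans (ltW (archi_boundP (expR_ge0 A))) _; rewrite ler_nat.
rewrite -[A]expRK ler_ln ?posrE ?expR_gt0//; exact: lt_le_trans (expR_gt0 A) h.
Qed.

Lemma powR_natE n : (0 < n)%N -> (n%:R : R) `^ 4^-1 = expR (ln (n%:R : R) / 4).
Proof. by move=> n0; rewrite /powR pnatr_eq0 eqn0Ngt n0/= mulrC. Qed.

Lemma sqrt_natE n : (0 < n)%N -> Num.sqrt (n%:R : R) = ((n%:R : R) `^ 4^-1) ^+ 2.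
Proof.
move=> n0; rewrite powR_natE// -expRM_natl.
have e : n%:R = expR (2%:R * (ln (n%:R : R) / 4)) ^+ 2.
  rewrite -expRM_natl (_ : _ * _ = ln n%:R); last by field.
  by rewrite lnK ?posrE ?ltr0n.
by rewrite {1}e sqrtr_sqr ger0_norm ?expR_ge0.
Qed.

(** Used at [y = ln n]. A cube is needed since the remainder relative to the gain is of order
    [y^2 / n^(1/4)]; 384 is [4^3 * 3!]. *)
Lemma expR_ge_cube (y : R) : 0 <= y -> y ^+ 3 / 384 <= expR (y / 4).
Proof.
move=> y0; have := @expR_ge1Dxn R (y / 4) 2; rewrite divr_ge0// => /(_ isT).
rewrite (_ : (3`!)%:R = 6 :> R)// => h.
have e : (y / 4) ^+ 3 / 6 = y ^+ 3 / 384 by field.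
rewrite e in h; lra.
Qed.

Lemma ln_succ_le n : (2 <= n)%N -> ln (n.+1%:R : R) <= 2 * ln (n%:R : R).
Proof.
move=> n2; have n0 : (0 < n)%N by exact: leq_trans n2.
rewrite mulr_natl -lnXn ?ltr0n// ler_ln ?posrE ?exprn_gt0 ?ltr0n//.
by rewrite -natrX ler_nat expnS expn1; nia.
Qed.

(** In the numerator [K] comes from the single codeword, [ln (n + 1)] from counting types, and
    [ln n / 2] from the surplus [1 / sqrt n]. *)
Lemma remainder_cvg0 (c K x : R) : 0 < c -> 0 <= x ->
  (fun n => - (K + x * ln (n.+1%:R : R) + ln (n%:R : R) / 2) /
     (c * ((n%:R : R) `^ 4^-1 / ln (n%:R : R)))) @ \oo --> (0 : R).
Proof.
move=> c0 x0.
pose A := `|K| + 2 * x + 1; have A0 : 0 < A by rewrite /A; have := normr_ge0 K; lra.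
apply/cvgrPdist_le => e e0.
have [N hN] := ln_nat_ge (1 + A * 384 / (c * e)).
exists (maxn N 2) => // n /=; rewrite geq_max => /andP[nN n2].
have n0 : (0 < n)%N by exact: leq_trans n2.
have := hN n nN; set y := ln n%:R => hy.
have ce0 : 0 < c * e by exact: mulr_gt0.
have D0 : 0 <= A * 384 / (c * e) by apply: divr_ge0; [lra|exact: ltW].
have y1 : 1 <= y by lra.
have y0 : 0 < y by lra.
have hr := expR_ge_cube (ltW y0).
rewrite powR_natE// -/y; set r := expR _ in hr *.
have r0 : 0 < r by exact: expR_gt0.
have den0 : 0 < c * (r / y) by apply: mulr_gt0 => //; exact: divr_gt0.
rewrite sub0r normrN mulNr normrN normrM normfV (gtr0_norm den0).
have num : `|K + x * ln n.+1%:R + y / 2| <= A * y.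
  have h1 := ln_succ_le n2; rewrite -/y in h1.
  have h2 : 0 <= ln (n.+1%:R : R) by rewrite ln_ge0// ler1n.
  have h3 := ler_wpM2l x0 h1; have h4 := mulr_ge0 x0 h2.
  have h5 : `|K| <= `|K| * y by rewrite ler_peMr.
  have := ler_norm K; have := ler_norm (- K); rewrite normrN => h6 h7.
  clear -h1 h2 h3 h4 h5 h6 h7 y1.
  by rewrite ler_norml /A; apply/andP; split; lra.
rewrite ler_pdivrMr//; apply: (le_trans num).
rewrite mulrA mulrA ler_pdivlMr//.
have h : A * 384 <= c * e * y by rewrite [leRHS]mulrC -ler_pdivrMr//; lra.
have h' : y ^+ 2 * (A * 384) <= y ^+ 2 * (c * e * y) by rewrite ler_wpM2l ?sqr_ge0.
have h'' : e * c * (y ^+ 3 / 384) <= e * c * r by rewrite ler_wpM2l// mulr_ge0// ltW.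
lra.
Qed.

End Asymptotics.

Theorem theorem13 (R : realType) (X Y : finType) (W : X -> Y -> R) (eps : R) :
  channel W -> A1 W -> 0 < eps < 1 ->
  exists c1 : R, 0 < c1 /\
  exists o : nat -> R, (o @ \oo --> (0 : R)) /\
  exists N : nat, forall n : nat, (N <= n)%N -> (2 <= n)%N ->
  forall (M : nat) (f : 'I_M -> {ffun 'I_n -> X}) (g : {ffun 'I_n -> Y} -> 'I_M),
    (0 < M)%N ->
    (forall m, ~ Pistar_nbhd W eps ((n%:R `^ (4^-1) * ln (n%:R : R))^-1) (ptype (f m))) ->
    avg_err W f g <= eps ->
    ln (M%:R : R) <= n%:R * capacity W - Num.sqrt (n%:R * Veps W eps) * teps eps
                     - c1 * n%:R `^ (4^-1) / ln (n%:R : R) * (1 + o n).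
Proof.
move=> chW a1 eps01.
have [P0 [dP0 oP0]] := A1_opt a1.
have [l [l01 lq]] := opt_lower_bound chW dP0.
have [c [K [B [c0 prob]]]] := codeword_prob chW a1 eps01 dP0 oP0 l01 lq.
exists c; split => //.
exists (fun n => - (K + #|X|%:R * ln (n.+1%:R : R) + ln (n%:R : R) / 2) /
     (c * ((n%:R : R) `^ 4^-1 / ln (n%:R : R)))); split.
  exact: remainder_cvg0.
(* From [y >= 32] follows [y^2 >= 384], so the cubic bound gives [n^(1/4) >= y]; the summand [|B|]
   then gives [sqrt n >= B]. *)
have [N hN] := ln_nat_ge (32 + `|B|).
exists N => n /hN; set y := ln n%:R => hy n2 M f g M0 far err.
have n0 : (0 < n)%N by exact: leq_trans n2.
have nR0 : 0 < n%:R :> R by rewrite ltr0n.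
have B0 := normr_ge0 B.
have y32 : 32 <= y by lra.
have y0 : 0 < y by lra.
have hr := expR_ge_cube (ltW y0); rewrite -powR_natE// in hr.
set r := n%:R `^ 4^-1 in hr far *.
have hcube : y * (y * y) / 384 <= r by rewrite -expr2 -exprS.
have yy : 384 * y <= y * (y * y).
  rewrite mulrC ler_wpM2l ?(ltW y0)//.
  have := ler_pM (ler0n _ 32) (ler0n _ 32) y32 y32; lra.
have yr : y <= r by lra.
have r0 : 0 < r by lra.
have sE : Num.sqrt n%:R = r ^+ 2 by exact: sqrt_natE.
set d := (r * y)^-1 in far.
have sd : Num.sqrt n%:R * d = r / y.
  by rewrite sE /d; field; rewrite !gt_eqF.
have d01 : 0 <= d <= 1.
  have ry0 : 0 < r * y by exact: mulr_gt0.
  rewrite /d invr_ge0 (ltW ry0)/= invf_le1//.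
  have : r * 1 <= r * y by rewrite ler_wpM2l ?(ltW r0)//; lra.
  lra.
have Bs : B <= Num.sqrt n%:R.
  rewrite sE; apply: (@le_trans _ _ r); first by have := ler_norm B; lra.
  by rewrite expr2 ler_peMr ?ltW//; lra.
have sd1 : 1 <= Num.sqrt n%:R * d by rewrite sd ler_pdivlMr// mul1r.
set a := n%:R * capacity W - Num.sqrt (n%:R * Veps W eps) * teps eps - c * (r / y) + K.
have s0 : 0 < Num.sqrt n%:R :> R by rewrite sqrtr_gt0.
(* Count vectors not adding up to [n] yield no distribution, which is why the converse asks for one
   only at labels in use. *)
pose Q (t : {ffun X -> 'I_n.+1}) := tilt W P0 l (freq t).
have QE m : Q (counts (f m)) = tilt W P0 l (ptype (f m)) by rewrite /Q freq_counts.
have dP m : is_dist (ptype (f m) : X -> R) by exact: ptype_dist.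
have Qdist m : is_dist (Q (counts (f m))).
  by rewrite QE; exact: (tilt_dist chW dP0 l01 (dP m)).
have Qpos m i z : 0 < W (f m i) z -> 0 < Q (counts (f m)) z.
  move=> Wz; rewrite QE; apply: (tilt_gt0 chW l01 (dP m)).
  exact: (channel_ll_opt chW dP0 oP0 Wz).
have key := sum_code_prob_le chW Qdist Qpos M0 (expR_gt0 a) err.
(* Each codeword stays below the threshold [a] with probability at least [eps + 1 / sqrt n]; the
   surplus is what bounds [M]. *)
have low : M%:R * (eps + (Num.sqrt n%:R)^-1) <= M%:R * eps + expR a * #|{ffun X -> 'I_n.+1}|%:R.
  apply: le_trans key; rewrite -[X in X%:R * _]card_ord -sum1_card natr_sum mulr_suml.
  apply: ler_sum => m _; rewrite mul1r QE expRK /a -sd.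
  exact: (prob n (f m) d n0 Bs d01 sd1 (far m)).
have M0' : 0 < M%:R :> R by rewrite ltr0n.
have hM : M%:R <= Num.sqrt n%:R * (expR a * (n.+1%:R ^+ #|X|)).
  have : M%:R / Num.sqrt n%:R <= expR a * #|{ffun X -> 'I_n.+1}|%:R.
    by move: low; rewrite mulrDr; lra.
  by rewrite card_ffun card_ord natrX ler_pdivrMr// mulrC.
have lns : ln (Num.sqrt n%:R : R) = y / 2.
  by rewrite sE /r powR_natE// -expRM_natl expRK -/y; field.
have lnM' : ln (M%:R : R) <= y / 2 + (a + #|X|%:R * ln (n.+1%:R : R)).
  rewrite -lns -[a]expRK mulr_natl -lnXn ?ltr0n// -!lnM ?posrE ?mulr_gt0 ?expR_gt0 ?exprn_gt0 ?ltr0n//.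
  by rewrite ler_ln ?posrE ?mulr_gt0 ?expR_gt0 ?exprn_gt0 ?ltr0n.
apply: (le_trans lnM').
(* The sequence [o] was chosen to make both sides equal. *)
rewrite le_eqVlt; apply/orP; left; apply/eqP; rewrite /a.
by field; rewrite !gt_eqF.
Qed.
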